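(* Let $\beta$ be a real number such that both $\beta$ and $\beta^2$ are irrational and non-Liouville. There exist constants $c'=c'(\beta)>0$ and $X_0=X_0(\beta)$ such that for all $\theta\in\mathbb{R}$ and all real $X\ge X_0$, $$\operatorname{Re}\sum_{1\le n\le X}e(-\theta n\lfloor\beta n\rfloor)\ \ge\ -X^{1-c'}.$$
   Context: $e(x)=e^{2\pi i x}$, $\lfloor x\rfloor$ is the greatest integer $\le x$, and the sum is over integers $n$. A real number $\beta$ is non-Liouville if there exist $m=m(\beta)>0$ and $M=M(\beta)\ge 1$ such that the inequality $0<\left|\beta-\frac{a}{q}\right|<\frac{m}{q^M}$ has no solutions in integers $a,q$ with $q\ge 1$. *)

(* Defs.v *)
From mathcomp Require Import all_boot all_order all_algebra.
From mathcomp Require Import all_classical all_reals all_analysis.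
From mathcomp Require Import complex.

Set Implicit Arguments.
Unset Strict Implicit.
Unset Printing Implicit Defensive.

Import Order.TTheory GRing.Theory Num.Theory.
Local Open Scope ring_scope.

(* e(x) = exp(2 pi i x), written with Euler's formula since the complex
   exponential is not available. *)
Definition e (R : realType) (x : R) : R[i] :=
  Complex (cos (2 * pi * x)) (sin (2 * pi * x)).

(* The exponent M is a real number, so q^M is the real power `^. *)
Definition non_liouville (R : realType) (beta : R) : Prop :=
  exists m M : R, [/\ 0 < m, 1 <= M &
    ~ exists a q : int,
        1 <= q /\ 0 < `|beta - a%:~R / q%:~R| < m / (q%:~R `^ M)].

(* Main.v *)
(* Write f(n) = n floor(beta n), let P be the length of the sum S and let z be a
   small power of P, so that every loss below is a bounded power of z.  Assume
   |S| > P / z.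

   By van der Corput's inequality, many shifts h have a large correlation
   sum_n e(-theta (f(n + h) - f(n))).  On each of the two sets where
   k = floor(beta (n + h)) - floor(beta n) is constant, the phase is linear in n
   up to a piecewise smooth function of the fractional part of beta n; expanding
   the latter with the Fejer kernel yields integers w = theta h + O(z^K) and l
   with k theta + (theta h - w) beta - l = O(z^K / P).  Two such relations with
   non-proportional (k, h) exist because beta is non-Liouville, and they give
   theta D = u + v beta + small with small integers D, u, v.  Substituting into
   the relations of a much longer range of h and applying the pigeonhole
   principle to v k + u h - D w leaves a multiple v (h - h') of beta ^ 2 very
   close to an integer, so v = 0.  Hence theta = u / D + xi, and shifts by large
   multiples of D improve this to |xi| <= z^f / P ^ 2.

   For such theta, split n according to its residue a modulo D.  If D does not
   divide u a, the class cancels, because floor(beta n) is equidistributed modulo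
   D.  Otherwise it contributes about sum_j cos(2 pi xi beta D^2 j^2), which is
   essentially nonnegative because int_0^x cos(t ^ 2) dt >= 0. *)
Require Import Defs.
From mathcomp Require Import all_boot all_order all_algebra.
From mathcomp Require Import all_classical all_reals all_analysis.
From mathcomp Require Import complex ring lra zify.

Set Implicit Arguments.
Unset Strict Implicit.
Unset Printing Implicit Defensive.

Import Order.TTheory GRing.Theory Num.Theory.
Import numFieldNormedType.Exports.
Local Open Scope ring_scope.

Local Notation nrm := Normc.normc.

(** * The character [e] and the norm on [R[i]] *)

Lemma eE0 (R : realType) : e (0 : R) = 1.
Proof. by rewrite /e mulr0 cos0 sin0. Qed.

Lemma eD (R : realType) (x y : R) : e (x + y) = e x * e y.
Proof.
rewrite /e mulrDr cosD sinD; apply/eqP; rewrite eq_complex /=.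
by apply/andP; split; apply/eqP => //; rewrite addrC.
Qed.

Lemma eN (R : realType) (x : R) : e (- x) = (e x)^*%C.
Proof. by rewrite /e mulrN cosN sinN. Qed.

Lemma e_nat (R : realType) (n : nat) : e (n%:R : R) = 1.
Proof.
elim: n => [|n IH]; first exact: eE0.
rewrite -natr1 eD IH mul1r /e mulr1 mulrC mulr_natr cos2pi sin2pi.
by [].
Qed.

Lemma e_int (R : realType) (k : int) : e (k%:~R : R) = 1.
Proof.
case: k => n; first exact: e_nat.
by rewrite NegzE mulrNz eN e_nat conjc1.
Qed.

Lemma eDint (R : realType) (x : R) (k : int) : e (x + k%:~R) = e x.
Proof. by rewrite eD e_int mulr1. Qed.

Lemma eMn (R : realType) (x : R) (n : nat) : e (x * n%:R) = e x ^+ n.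
Proof.
elim: n => [|n IH]; first by rewrite mulr0 eE0.
by rewrite -natr1 mulrDr mulr1 eD IH exprSr.
Qed.

Lemma nrm_ge0 (R : realType) (z : R[i]) : 0 <= nrm z.
Proof. by case: z => a b; exact: sqrtr_ge0. Qed.

Lemma nrm0 (R : realType) : nrm (0 : R[i]) = 0.
Proof. exact: Normc.normc0. Qed.

Lemma nrm1 (R : realType) : nrm (1 : R[i]) = 1.
Proof. exact: Normc.normc1. Qed.

Lemma nrmN (R : realType) (z : R[i]) : nrm (- z) = nrm z.
Proof. exact: (@normrN R (Rcomplex R) z). Qed.

Lemma nrmB (R : realType) (z w : R[i]) : nrm (z - w) = nrm (w - z).
Proof. by rewrite -opprB nrmN. Qed.

Lemma le_nrmD (R : realType) (z w : R[i]) : nrm (z + w) <= nrm z + nrm w.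
Proof. exact: (@ler_normD R (Rcomplex R) z w). Qed.

Lemma le_nrmB (R : realType) (z w : R[i]) : nrm (z - w) <= nrm z + nrm w.
Proof. by rewrite -[X in _ <= _ + X]nrmN le_nrmD. Qed.

Lemma le_nrm_sum (R : realType) (I : Type) (r : seq I) (P : pred I)
    (F : I -> R[i]) :
  nrm (\sum_(i <- r | P i) F i) <= \sum_(i <- r | P i) nrm (F i).
Proof.
elim/big_ind2: _ => [|x1 x2 y1 y2 h1 h2|//]; first by rewrite nrm0.
exact: le_trans (le_nrmD _ _) (lerD h1 h2).
Qed.

Lemma nrm_e (R : realType) (x : R) : nrm (e x) = 1.
Proof. by rewrite /e /Normc.normc cos2Dsin2 sqrtr1. Qed.

Lemma nrmC (R : realType) (z : R[i]) : nrm z^*%C = nrm z.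
Proof. by case: z => a b /=; rewrite sqrrN. Qed.

Lemma nrm_sqr (R : realType) (z : R[i]) : (nrm z ^+ 2)%:C%C = z * z^*%C.
Proof.
case: z => a b; rewrite /Normc.normc sqr_sqrtr ?addr_ge0 ?sqr_ge0 //.
by apply/eqP; rewrite eq_complex /=; apply/andP; split; apply/eqP; ring.
Qed.

Lemma Re_le_nrm (R : realType) (z : R[i]) : `|complex.Re z| <= nrm z.
Proof.
by case: z => a b /=; rewrite -sqrtr_sqr ler_wsqrtr // lerDl sqr_ge0.
Qed.

Lemma nrm_real (R : realType) (x : R) : nrm x%:C%C = `|x|.
Proof. by rewrite /= expr0n /= addr0 sqrtr_sqr. Qed.

Lemma nrm_le_ReIm (R : realType) (z : R[i]) :
  nrm z <= `|complex.Re z| + `|complex.Im z|.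
Proof.
case: z => a b /=; rewrite -(ger0_norm (addr_ge0 (normr_ge0 a) (normr_ge0 b))).
rewrite -sqrtr_sqr ler_wsqrtr // sqrrD !real_normK ?num_real //.
have := mulr_ge0 (normr_ge0 a) (normr_ge0 b); lra.
Qed.

(** * Elementary inequalities for sine, cosine and [e] *)

Lemma pi_le4 (R : realType) : (pi : R) <= 4.
Proof. have := @pihalf_lt2 R; lra. Qed.

Lemma MVT_R (R : realType) (f df : R -> R) (a b : R) : a <= b ->
  (forall x : R, a <= x <= b -> is_derive x 1 f (df x)) ->
  exists c, [/\ a <= c, c <= b & f b - f a = df c * (b - a)].
Proof.
move=> ab fd.
have fd' x : x \in `]a, b[ -> is_derive x 1 f (df x).
  by rewrite in_itv /= => /andP[ax xb]; apply: fd; rewrite !ltW.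
have fc : ({within `[a, b], continuous f})%classic.
  apply: derivable_within_continuous => x; rewrite in_itv /= => xab.
  by have [] := fd x xab.
have [c cab ->] := MVT_segment ab fd' fc.
by exists c; move: cab; rewrite in_itv /= => /andP[].
Qed.

Lemma cos_lip (R : realType) (x y : R) : `|cos x - cos y| <= `|x - y|.
Proof.
wlog xy : x y / y <= x.
  move=> H; have [/H//|/ltW/H] := leP y x; by rewrite distrC (distrC y).
have [c [_ _ ->]] := MVT_R xy (fun x _ => is_derive_cos x).
by rewrite normrM normrN ler_piMl // sin_max.
Qed.

Lemma sin_lip (R : realType) (x y : R) : `|sin x - sin y| <= `|x - y|.
Proof.
wlog xy : x y / y <= x.
  move=> H; have [/H//|/ltW/H] := leP y x; by rewrite distrC (distrC y).
have [c [_ _ ->]] := MVT_R xy (fun x _ => is_derive_sin x).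
by rewrite normrM ler_piMl // cos_max.
Qed.

(** Since 2 pi is at most 8, the real and imaginary parts are each 8-Lipschitz; adding them gives
    16. *)
Lemma e_lip (R : realType) (x y : R) : nrm (e x - e y) <= 16 * `|x - y|.
Proof.
apply: le_trans (nrm_le_ReIm _) _ => /=.
have h1 := cos_lip (2 * pi * x) (2 * pi * y).
have h2 := sin_lip (2 * pi * x) (2 * pi * y).
have : `|2 * pi * x - 2 * pi * y| <= 8 * `|x - y|.
  rewrite -mulrBr normrM ler_wpM2r // ger0_norm ?mulr_ge0 ?pi_ge0 //.
  have := @pi_le4 R; lra.
lra.
Qed.

(** Half-angle formula: cos x = 1 - 2 sin(x/2)^2, and |sin(x/2)| is at most |x/2|. *)
Lemma cos_ge_quad (R : realType) (x : R) : 1 - x ^+ 2 / 2 <= cos x.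
Proof.
have -> : x = x / 2 *+ 2 by rewrite -mulr_natr; field.
have := sin_lip (x / 2) 0; rewrite sin0 !subr0 cos_mulr2n cos2sin2 => h.
have : sin (x / 2) ^+ 2 <= (x / 2) ^+ 2.
  by rewrite -(real_normK (num_real (sin _))) -(real_normK (num_real (x / 2)))
    ler_sqr ?nnegrE.
rewrite -[(x / 2) *+ 2]mulr_natr; move=> h2.
rewrite mulrnBl mulr_natr; nra.
Qed.

Lemma sin_ge_half (R : realType) (y : R) : 0 <= y <= 1 -> y / 2 <= sin y.
Proof.
move=> /andP[y0 y1]; have [c [c0 cy]] := MVT_R y0 (fun x _ => is_derive_sin x).
rewrite sin0 !subr0 => ->; have := cos_ge_quad c.
have : c ^+ 2 <= 1 by rewrite expr_le1 // (le_trans cy).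
nra.
Qed.

(** When pi x is at most 1 this is [sin_ge_half], as pi is at least 2. Beyond that, sine is still
    increasing up to pi/2, so it exceeds sin 1 >= 1/2, while x/2 is at most 1/4. *)
Lemma sin_pi_ge (R : realType) (x : R) : 0 <= x <= 1 / 2 -> x / 2 <= sin (pi * x).
Proof.
move=> /andP[x0 x1]; have p2 := @pi_ge2 R; have p4 := @pi_le4 R.
have [y1|y1] := leP (pi * x) 1.
  have : 0 <= pi * x <= 1 by rewrite y1 mulr_ge0 // pi_ge0.
  by move/sin_ge_half; nra.
have h : sin (1 : R) < sin (pi * x) by rewrite ltr_sin // in_itv /=; nra.
have : (1 : R) / 2 <= sin 1 by apply: sin_ge_half; rewrite ler01 lexx.
lra.
Qed.

(** Factoring out e(x/2) shows |1 - e(x)| = 2 |sin(pi x)|, and [sin_pi_ge] applies. *)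
Lemma nrm_1Be (R : realType) (x : R) : `|x| <= 1 / 2 -> `|x| <= nrm (1 - e x).
Proof.
move=> hx; have -> : nrm (1 - e x) = 2 * `|sin (pi * x)|.
  have -> : 1 - e x = - e (x / 2) * (e (x / 2) - e (- (x / 2))).
    by rewrite -[1]eE0 mulNr mulrBr -!eD opprB; congr (e _ - e _); field.
  rewrite Normc.normcM nrmN nrm_e mul1r /e mulrN cosN sinN /= subrr opprK.
  have -> : 2 * pi * (x / 2) = pi * x by field.
  rewrite expr0n /= add0r sqrtr_sqr -[X in X + X]mulr1 -mulrDr normrM mulrC.
  by rewrite [`|1 + 1|]ger0_norm.
wlog x0 : x hx / 0 <= x => [H|].
  have [/H|x0] := leP 0 x; first exact.
  by rewrite -normrN -[`|sin _|]normrN -sinN -mulrN H ?normrN // oppr_ge0 ltW.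
rewrite ger0_norm // in hx *; have := sin_pi_ge (x := x); rewrite x0 hx.
by move=> /(_ isT); have := ler_norm (sin (pi * x)); lra.
Qed.

(** * Geometric sums and roots of unity *)

Lemma nearest_int (R : realType) (x : R) : exists l : int, `|x - l%:~R| <= 1 / 2.
Proof.
exists (Num.floor (x + 1 / 2)); have := floor_itv (x + 1 / 2).
by rewrite intrD => /andP[h1 h2]; rewrite ler_norml; apply/andP; split; lra.
Qed.

(** Multiplication by 1 - e(x) telescopes the sum, and |1 - e(x)| is at least the distance from x to
    its nearest integer. The product form avoids dividing by a distance that may vanish. *)
Lemma geom_e (R : realType) (x : R) (J : nat) :
  exists l : int, `|x - l%:~R| * nrm (\sum_(n < J) e (x * n%:R)) <= 2.
Proof.
have [l hl] := nearest_int x; exists l.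
have ex : e x = e (x - l%:~R) by rewrite -{1}(subrK l%:~R x) eDint.
have h : nrm (1 - e x) * nrm (\sum_(n < J) e (x * n%:R)) = nrm (1 - e x ^+ J).
  rewrite -Normc.normcM nrmB subrX1 !Normc.normcM (nrmB 1); congr (_ * nrm _).
  by apply: eq_bigr => n _; rewrite eMn.
apply: (@le_trans _ _ (nrm (1 - e x ^+ J))).
  by rewrite -h ex ler_wpM2r ?nrm_ge0 // nrm_1Be.
by apply: le_trans (le_nrmB _ _) _; rewrite nrm1 -eMn nrm_e.
Qed.

Lemma e_neq1 (R : realType) (x : R) : 0 < `|x| < 1 -> e x != 1.
Proof.
move=> /andP[x0 x1]; have [l hl] := nearest_int x.
have ex : e x = e (x - l%:~R) by rewrite -{1}(subrK l%:~R x) eDint.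
apply/eqP => ex1; move: (nrm_1Be hl); rewrite -ex ex1 subrr nrm0 normr_le0 subr_eq0.
move=> /eqP xl; move: x0 x1; rewrite xl -intr_norm ltr0z ltrz1.
lia.
Qed.

Lemma sum_e_frac (R : realType) (N : nat) (d : int) : (0 < `|d| < N)%N ->
  \sum_(j < N) e (d%:~R / N%:R * j%:R : R) = 0.
Proof.
move=> /andP[d0 dN]; have N0 : (0 < N)%N by exact: leq_ltn_trans dN.
have NR : 0 < N%:R :> R by rewrite ltr0n.
have : e (d%:~R / N%:R : R) != 1.
  apply: e_neq1; rewrite normrM normfV -intr_norm (ger0_norm (ltW NR)).
  rewrite divr_gt0 ?ltr0z ?normr_gt0 -?absz_gt0 //= ltr_pdivrMr // mul1r.
  by rewrite -abszE [_%:~R]/(`|d|%N%:R) ltr_nat.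
rewrite -subr_eq0 => z1; apply: (mulfI z1); rewrite mulr0.
under eq_bigr => j _ do rewrite eMn.
by rewrite -subrX1 -eMn mulfVK ?gt_eqF // e_int subrr.
Qed.

(** * Approximation by Fejer sums *)

(** The Fejer kernel divided by [N], so that for positive [N] its value at the integers is 1. *)
Definition fejer (R : realType) (N : nat) (y : R) : R :=
  (nrm (\sum_(i < N) e (y * i%:R)) / N%:R) ^+ 2.

Lemma fejer_ge0 (R : realType) (N : nat) (y : R) : 0 <= fejer N y.
Proof. exact: sqr_ge0. Qed.

Lemma conjc_sum (R : realType) (I : Type) (r : seq I) (F : I -> R[i]) :
  ((\sum_(i <- r) F i)^*)%C = \sum_(i <- r) ((F i)^*)%C.
Proof. exact: (rmorph_sum (@conjc R)). Qed.

Lemma fejer_expand (R : realType) (N : nat) (y : R) :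
  ((fejer N y)%:C)%C = (N%:R ^- 2) *
    \sum_(i < N) \sum_(k < N) e (y * (i%:Z - k%:Z)%:~R).
Proof.
rewrite /fejer exprMn exprVn mulrC rmorphM /= nrm_sqr; congr (_ * _).
  by rewrite fmorphV rmorphXn /= rmorph_nat.
rewrite conjc_sum mulr_suml; apply: eq_bigr => i _.
rewrite mulr_sumr; apply: eq_bigr => k _.
by rewrite -eN -eD intrB mulrBr.
Qed.

(** Expand the kernel and sum over j first: off-diagonal pairs give a full sum of a nontrivial root
    of unity, hence 0, and the N diagonal pairs give N each. *)
Lemma fejer_sum (R : realType) (N : nat) (x : R) : (0 < N)%N ->
  \sum_(j < N) fejer N (x - j%:R / N%:R) = 1.
Proof.
move=> N0; have NR : N%:R != 0 :> R[i] by rewrite pnatr_eq0 -lt0n.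
apply: (@complexI R); rewrite rmorph_sum /=.
under eq_bigr => j _ do rewrite fejer_expand.
rewrite -mulr_sumr exchange_big /=.
under eq_bigr => i _ do rewrite exchange_big /=.
have -> : \sum_(i < N) \sum_(k < N) \sum_(j < N)
    e ((x - j%:R / N%:R) * (i%:Z - k%:Z)%:~R) = \sum_(i < N) (N%:R : R[i]).
  apply: eq_bigr => i _; rewrite (bigD1 i) //= [X in X + _](_ : _ = N%:R); last first.
    by under eq_bigr => j _ do rewrite subrr mulr0 eE0; rewrite sumr_const card_ord.
  rewrite big1 ?addr0 // => k ki.
  transitivity (\sum_(j < N) e (x * (i%:Z - k%:Z)%:~R) *
      e ((k%:Z - i%:Z)%:~R / N%:R * j%:R : R)).
    apply: eq_bigr => j _; rewrite -eD; congr e; rewrite !intrB; ring.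
  rewrite -mulr_sumr sum_e_frac ?mulr0 //.
  have : (k : nat) != i by [].
  by have := ltn_ord i; have := ltn_ord k; lia.
by rewrite sumr_const card_ord -(mulr_natl (N%:R : R[i])) -expr2 mulVf ?expf_neq0.
Qed.

Lemma fejer_le (R : realType) (N : nat) (y k : R) : 0 < k -> (0 < N)%N ->
  (forall l : int, k < `|y - l%:~R|) -> fejer N y <= 4 / (N%:R * k) ^+ 2.
Proof.
move=> k0 N0 h; have NR : 0 < N%:R :> R by rewrite ltr0n.
have [l hl] := geom_e y N; have hk := h l.
have -> : 4 / (N%:R * k) ^+ 2 = (2 / k / N%:R) ^+ 2 :> R.
  by field; rewrite !gt_eqF.
rewrite /fejer ler_sqr ?nnegrE ?divr_ge0 ?nrm_ge0 ?ler0n ?(ltW k0) //.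
rewrite ler_pM2r ?invr_gt0 // ler_pdivlMr // mulrC.
by apply: le_trans hl; rewrite ler_wpM2r ?nrm_ge0 // ltW.
Qed.

(* Replaces [G] by the trigonometric polynomial
   [x |-> \sum_(j < N) G (j / N) * fejer N (x - j / N)]: since the Fejer kernel
   is nonnegative and its translates by [j / N] sum to [1], no integral is
   needed. *)
Lemma fejer_approx (R : realType) (N J : nat) (a : nat -> R[i]) (x : nat -> R)
    (G : R -> R[i]) (bad : pred R) (k L B : R) :
  (0 < N)%N -> 0 < k -> 0 <= L ->
  (forall n, nrm (a n) <= 1) -> (forall y, nrm (G y) <= 1) ->
  (forall y (l : int), G (y + l%:~R) = G y) ->
  (forall y z, ~~ bad y -> `|y - z| <= k -> nrm (G y - G z) <= L) ->
  (forall i i' : 'I_N,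
     \sum_(j < N) G (j%:R / N%:R) * e (- (j%:R / N%:R) * (i%:Z - i'%:Z)%:~R) = 0
     \/ nrm (\sum_(n < J) a n * e (x n * (i%:Z - i'%:Z)%:~R)) <= B) ->
  0 <= B ->
  nrm (\sum_(n < J) a n * G (x n)) <=
    N%:R * B + J%:R * (L + 8 / (N%:R * k ^+ 2)) + 2 * (\sum_(n < J) bad (x n))%:R.
Proof.
move=> N0 k0 L0 ha hG Gper Glip hB B0.
have NR : 0 < N%:R :> R by rewrite ltr0n.
have NC : N%:R != 0 :> R[i] by rewrite pnatr_eq0 -lt0n.
pose Gt y := \sum_(j < N) G (j%:R / N%:R) * ((fejer N (y - j%:R / N%:R))%:C)%C.
have hGt y : nrm (G y - Gt y) <= L + 8 / (N%:R * k ^+ 2) + 2 * (bad y)%:R.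
  have -> : G y - Gt y = \sum_(j < N) (G y - G (j%:R / N%:R)) *
      ((fejer N (y - j%:R / N%:R))%:C)%C.
    under [RHS]eq_bigr => j _ do rewrite mulrBl.
    by rewrite sumrB -mulr_sumr -rmorph_sum fejer_sum // mulr1.
  apply: le_trans (le_nrm_sum _ _ _) _.
  (* Three cases: at a bad y only |G y - G z| <= 2 is available; at a node within [k] of y modulo 1
     the difference is at most [L]; at any other node the kernel itself is small. *)
  have hj (j : 'I_N) : nrm ((G y - G (j%:R / N%:R)) *
        ((fejer N (y - j%:R / N%:R))%:C)%C) <=
      (L + 2 * (bad y)%:R) * fejer N (y - j%:R / N%:R) + 8 / (N%:R * k) ^+ 2.
    rewrite Normc.normcM nrm_real ger0_norm ?fejer_ge0 //.
    have F0 := fejer_ge0 N (y - j%:R / N%:R).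
    have h2 : nrm (G y - G (j%:R / N%:R)) <= 2.
      by apply: le_trans (le_nrmB _ _) _; apply: (lerD (hG _) (hG _)).
    have q0 : 0 <= 8 / (N%:R * k) ^+ 2 by rewrite divr_ge0 ?sqr_ge0.
    have [yb|yb] := boolP (bad y).
      rewrite mulr1; have : 0 <= L * fejer N (y - j%:R / N%:R) by exact: mulr_ge0.
      have := ler_wpM2r F0 h2; lra.
    rewrite mulr0 addr0.
    have [[l hl]|far] := pselect (exists l : int, `|y - j%:R / N%:R - l%:~R| <= k).
      have : nrm (G y - G (j%:R / N%:R)) <= L.
        by rewrite -(Gper (j%:R / N%:R) l) Glip // opprD addrA.
      by move=> /(ler_wpM2r F0); lra.
    have {far} : fejer N (y - j%:R / N%:R) <= 4 / (N%:R * k) ^+ 2.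
      apply: fejer_le => // l; rewrite ltNge; apply/negP => hl.
      by apply: far; exists l.
    have : 0 <= L * fejer N (y - j%:R / N%:R) by exact: mulr_ge0.
    have := ler_wpM2r F0 h2; lra.
  apply: le_trans (ler_sum _ (fun j _ => hj j)) _.
  rewrite big_split /= -mulr_sumr fejer_sum // mulr1 sumr_const card_ord.
  rewrite -[_ *+ N]mulr_natr.
  have -> : 8 / (N%:R * k) ^+ 2 * N%:R = 8 / (N%:R * k ^+ 2).
    by field; rewrite !gt_eqF.
  lra.
have hS : nrm (\sum_(n < J) a n * Gt (x n)) <= N%:R * B.
  (* Unnormalised discrete Fourier coefficients of G on the grid. Each is at most [N] in norm, so
     [hB] bounds every one of the N^2 terms by N B. *)
  pose W (i i' : 'I_N) := \sum_(j < N) G (j%:R / N%:R) *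
    e (- (j%:R / N%:R) * (i%:Z - i'%:Z)%:~R).
  have -> : \sum_(n < J) a n * Gt (x n) = (N%:R ^- 2) *
      \sum_(i < N) \sum_(i' < N) (W i i' *
        \sum_(n < J) a n * e (x n * (i%:Z - i'%:Z)%:~R)).
    transitivity (\sum_(n < J) (N%:R ^- 2) * \sum_(i < N) \sum_(i' < N)
        W i i' * (a n * e (x n * (i%:Z - i'%:Z)%:~R))).
      apply: eq_bigr => n _; rewrite /Gt.
      under eq_bigr => j _ do rewrite fejer_expand mulrCA mulr_sumr.
      rewrite -mulr_sumr mulrCA; congr (_ * _).
      rewrite exchange_big mulr_sumr; apply: eq_bigr => i _ /=.
      under eq_bigr => j _ do rewrite mulr_sumr.
      rewrite exchange_big mulr_sumr; apply: eq_bigr => i' _ /=.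
      rewrite mulr_suml mulr_sumr; apply: eq_bigr => j _.
      rewrite mulrBl -mulNr eD [LHS]mulrA [RHS]mulrACA.
      by congr (_ * _); exact: mulrC.
    rewrite -mulr_sumr; congr (_ * _).
    rewrite exchange_big; apply: eq_bigr => i _ /=.
    by rewrite exchange_big; apply: eq_bigr => i' _ /=; rewrite mulr_sumr.
  rewrite Normc.normcM.
  have -> : nrm (N%:R ^- 2 : R[i]) = N%:R ^- 2.
    rewrite -(rmorph_nat (real_complex R)) -rmorphXn -fmorphV nrm_real.
    by rewrite ger0_norm // invr_ge0 sqr_ge0.
  have hi (i i' : 'I_N) : nrm (W i i' *
      \sum_(n < J) a n * e (x n * (i%:Z - i'%:Z)%:~R)) <= N%:R * B.
    have [|hb] := hB i i'.
      by rewrite -/(W i i') => ->; rewrite mul0r nrm0 mulr_ge0.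
    rewrite Normc.normcM ler_pM ?nrm_ge0 //.
    apply: le_trans (le_nrm_sum _ _ _) _.
    rewrite -[leRHS]mulr1 mulr_natl -[X in _ *+ X]card_ord -sumr_const.
    by apply: ler_sum => j _; rewrite Normc.normcM nrm_e mulr1.
  rewrite mulrC ler_pdivrMr ?exprn_gt0 //.
  apply: le_trans (le_nrm_sum _ _ _) _.
  apply: (@le_trans _ _ (\sum_(i < N) \sum_(i' < N) N%:R * B)).
    by apply: ler_sum => i _; apply: le_trans (le_nrm_sum _ _ _) (ler_sum _ _).
  by rewrite !sumr_const card_ord -mulrnA expr2 -natrM mulr_natr.
have -> : \sum_(n < J) a n * G (x n) =
    \sum_(n < J) a n * Gt (x n) + \sum_(n < J) a n * (G (x n) - Gt (x n)).
  by rewrite -big_split /=; apply: eq_bigr => n _; rewrite -mulrDr addrC subrK.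
apply: le_trans (le_nrmD _ _) _; rewrite -addrA lerD //.
apply: le_trans (le_nrm_sum _ _ _) _.
have hn (n : 'I_J) : nrm (a n * (G (x n) - Gt (x n))) <=
    (L + 8 / (N%:R * k ^+ 2)) + 2 * (bad (x n))%:R.
  rewrite Normc.normcM; apply: le_trans (hGt (x n)).
  by rewrite -[leRHS]mul1r ler_wpM2r ?nrm_ge0.
apply: le_trans (ler_sum _ (fun n _ => hn n)) _.
by rewrite big_split /= sumr_const card_ord -mulr_sumr natr_sum [J%:R * _]mulr_natl.
Qed.

(** * The inequalities of van der Corput and Abel *)

(** Cauchy-Schwarz, from the nonnegative double sum of (r s - r t)^2. *)
Lemma sqr_sum_le (R : realType) (n : nat) (r : nat -> R) :
  (\sum_(t < n) r t) ^+ 2 <= n%:R * \sum_(t < n) r t ^+ 2.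
Proof.
have : 0 <= \sum_(s < n) \sum_(t < n) (r s - r t) ^+ 2.
  by apply: sumr_ge0 => s _; apply: sumr_ge0 => t _; exact: sqr_ge0.
have -> : \sum_(s < n) \sum_(t < n) (r s - r t) ^+ 2 =
    2 * (n%:R * \sum_(t < n) r t ^+ 2 - (\sum_(t < n) r t) ^+ 2).
  have -> : \sum_(s < n) \sum_(t < n) (r s - r t) ^+ 2 = \sum_(s < n)
      (n%:R * r s ^+ 2 - 2 * r s * (\sum_(t < n) r t) + \sum_(t < n) r t ^+ 2).
    apply: eq_bigr => s _.
    under eq_bigr => t _ do rewrite sqrrB.
    rewrite !big_split /= sumr_const card_ord mulr_natl sumrN.
    congr (_ - _ + _); rewrite mulr_sumr; apply: eq_bigr => t _.
    by rewrite -mulrA mulr_natl.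
  rewrite !big_split /= sumrN -mulr_sumr -mulr_suml -mulr_sumr sumr_const card_ord.
  rewrite -(mulr_natl _ n); ring.
lra.
Qed.

(** Extending a sequence by zero lets all its shifts be summed over one common range. *)
Lemma sum_window (V : nmodType) (F : nat -> V) (m L Q : nat) : (m + L <= Q)%N ->
  \sum_(t < Q) (if (m <= t)%N && (t - m < L)%N then F (t - m)%N else 0) =
  \sum_(n < L) F n.
Proof.
move=> mLQ; rewrite -(big_mkord xpredT (fun t =>
  if (m <= t)%N && (t - m < L)%N then F (t - m)%N else 0)).
rewrite (@big_cat_nat _ _ _ m) //=; last by lia.
rewrite big_nat big1 ?add0r => [|t tm]; last by rewrite ifF //; lia.
rewrite (@big_cat_nat _ _ _ (m + L)) //=; last by lia.
rewrite [X in _ + X]big_nat [X in _ + X]big1 ?addr0 => [|t tm]; last first.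
  by rewrite ifF //; lia.
rewrite -{1}[m]add0n big_addn addKn big_mkord; apply: eq_bigr => n _.
by rewrite addnK leq_addl ltn_ord.
Qed.

(** With truncated subtraction the argument of [tau] is |j - k|, and each positive distance is
    attained at most once on either side of j. *)
Lemma sum_dist_le (R : realType) (H j : nat) (tau : nat -> R) :
  (forall d, 0 <= tau d) -> (j < H)%N ->
  \sum_(k < H) tau ((j - k) + (k - j))%N <= tau 0 + 2 * \sum_(1 <= d < H) tau d.
Proof.
move=> tau0 jH; rewrite -(big_mkord xpredT (fun k => tau ((j - k) + (k - j))%N)).
rewrite (@big_cat_nat _ _ _ j) //=; last by lia.
rewrite [X in _ + X]big_ltn //= subnn addn0.
have h1 : \sum_(0 <= k < j) tau ((j - k) + (k - j))%N <= \sum_(1 <= d < H) tau d.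
  rewrite big_nat_rev /= add0n.
  have -> : \sum_(0 <= k < j) tau ((j - (j - k.+1)) + (j - k.+1 - j))%N =
      \sum_(1 <= d < j.+1) tau d.
    rewrite big_add1 /= !big_nat; apply: eq_bigr => k kj; congr tau; lia.
  rewrite [leRHS](@big_cat_nat _ _ _ j.+1) //= lerDl.
  by rewrite sumr_ge0.
have h2 : \sum_(j.+1 <= k < H) tau ((j - k) + (k - j))%N <= \sum_(1 <= d < H) tau d.
  have -> : \sum_(j.+1 <= k < H) tau ((j - k) + (k - j))%N =
      \sum_(1 <= d < H - j) tau d.
    rewrite -[j.+1]add1n big_addn !big_nat.
    by apply: eq_bigr => k kj; congr tau; lia.
  rewrite [leRHS](@big_cat_nat _ _ _ (H - j)) //=; [|lia|lia].
  by rewrite lerDl sumr_ge0.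
lra.
Qed.

(** Van der Corput's inequality with shifts by multiples of [D]. The sum is averaged over H shifts
    of the zero extension, Cauchy-Schwarz is applied in the position t, and the correlation of the
    shifts j and k depends only on |j - k|. The hypothesis H D <= P keeps the common range below 2
    P. *)
Lemma vdC (R : realType) (P D H : nat) (a : nat -> R[i]) :
  (H * D <= P)%N -> (forall n, nrm (a n) <= 1) ->
  nrm (\sum_(n < P) a n) ^+ 2 * H%:R <= 2 * P%:R * (P%:R +
    2 * \sum_(1 <= j < H) nrm (\sum_(n < P - j * D) a (n + j * D)%N * ((a n)^*)%C)).
Proof.
move=> HDP ha; set S := \sum_(n < P) a n.
pose tau j := nrm (\sum_(n < P - j * D) a (n + j * D)%N * ((a n)^*)%C).
rewrite -/(tau _); set Q := (P + H * D)%N.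
pose b t j := if (j * D <= t)%N && (t - j * D < P)%N then a (t - j * D)%N else 0.
have hb (j : 'I_H) : \sum_(t < Q) b t j = S.
  by apply: sum_window; have := ltn_ord j; rewrite /Q; nia.
have corr (j k : 'I_H) : (j <= k)%N ->
    \sum_(t < Q) b t j * ((b t k)^*)%C =
    \sum_(n < P - (k - j) * D) a (n + (k - j) * D)%N * ((a n)^*)%C.
  move=> jk; have kH := ltn_ord k.
  rewrite -(@sum_window _ (fun n => a (n + (k - j) * D)%N * ((a n)^*)%C) (k * D) _ Q);
    last by rewrite /Q; nia.
  apply: eq_bigr => t _; rewrite /b.
  have jkD : (j * D <= k * D)%N by rewrite leq_mul2r jk orbT.
  have E : ((k - j) * D = k * D - j * D)%N by rewrite mulnBl.
  rewrite E.
  have [kt|kt] := leqP (k * D) t; last first.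
    by rewrite /= oppr0 mulr0.
  have -> : (j * D <= t)%N by lia.
  rewrite /=; have [tP|tP] := ltnP (t - j * D) P; last first.
    by rewrite mul0r ifF //; lia.
  rewrite !ifT; [|lia|lia].
  by congr (a _ * _); lia.
have ncorr (j k : 'I_H) : nrm (\sum_(t < Q) b t j * ((b t k)^*)%C) =
    tau ((j - k) + (k - j))%N.
  have [jk|/ltnW kj] := leqP j k.
    by rewrite corr // /tau; have -> : (j - k + (k - j) = k - j)%N by lia.
  rewrite -nrmC conjc_sum.
  under eq_bigr => t _ do rewrite rmorphM /= conjcK mulrC.
  by rewrite corr // /tau; have -> : (j - k + (k - j) = j - k)%N by lia.
have tau0 d : 0 <= tau d by exact: nrm_ge0.
have tau0P : tau 0%N <= P%:R.
  apply: le_trans (le_nrm_sum _ _ _) _.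
  apply: (@le_trans _ _ (\sum_(n < P - 0 * D) 1)).
    apply: ler_sum => n _; rewrite Normc.normcM nrmC addn0 -[leRHS]mulr1.
    by rewrite ler_pM ?nrm_ge0.
  by rewrite sumr_const card_ord subn0.
have [->|H0] := eqVneq H 0%N.
  rewrite mulr0 mulr_ge0 ?addr_ge0 ?mulr_ge0 //.
  by rewrite sumr_ge0 // => j _; exact: nrm_ge0.
have HR : 0 < H%:R :> R by rewrite ltr0n lt0n.
have h1 : (H%:R * nrm S) ^+ 2 <=
    Q%:R * \sum_(t < Q) nrm (\sum_(j < H) b t j) ^+ 2.
  apply: le_trans (sqr_sum_le _ (fun t => nrm (\sum_(j < H) b t j))).
  have -> : H%:R * nrm S = nrm (\sum_(t < Q) \sum_(j < H) b t j).
    rewrite exchange_big /=.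
    under eq_bigr => j _ do rewrite hb.
    rewrite sumr_const card_ord -[S *+ H]mulr_natl Normc.normcM.
    by rewrite -(rmorph_nat (real_complex R)) nrm_real ger0_norm.
  by rewrite ler_sqr ?nnegrE ?nrm_ge0 ?sumr_ge0 ?le_nrm_sum // => t _; rewrite nrm_ge0.
have h2 : \sum_(t < Q) nrm (\sum_(j < H) b t j) ^+ 2 <=
    H%:R * (P%:R + 2 * \sum_(1 <= d < H) tau d).
  have -> : \sum_(t < Q) nrm (\sum_(j < H) b t j) ^+ 2 =
      nrm (\sum_(j < H) \sum_(k < H) \sum_(t < Q) b t j * ((b t k)^*)%C).
    rewrite -[LHS]ger0_norm ?sumr_ge0 // => [|t _]; last by rewrite sqr_ge0.
    rewrite -nrm_real rmorph_sum /=; congr (nrm _).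
    under eq_bigr => t _ do rewrite nrm_sqr conjc_sum mulr_suml.
    rewrite exchange_big; apply: eq_bigr => j _ /=.
    under eq_bigr => t _ do rewrite mulr_sumr.
    by rewrite exchange_big.
  apply: le_trans (le_nrm_sum _ _ _) _.
  rewrite [leRHS]mulr_natl -[X in _ *+ X]card_ord -sumr_const.
  apply: ler_sum => j _; apply: le_trans (le_nrm_sum _ _ _) _.
  under eq_bigr => k _ do rewrite ncorr.
  by apply: le_trans (sum_dist_le tau0 (ltn_ord j)) _; rewrite lerD2r.
have Q2 : Q%:R <= 2 * P%:R :> R.
  by rewrite -natrM ler_nat /Q; lia.
set M := P%:R + _ in h2 *.
have M0 : 0 <= M.
  by rewrite /M addr_ge0 ?ler0n ?mulr_ge0 ?sumr_ge0 // => d _; exact: tau0.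
have h3 : (H%:R * nrm S) ^+ 2 <= 2 * P%:R * (H%:R * M).
  apply: le_trans h1 _; apply: ler_pM => //.
  by rewrite sumr_ge0 // => t _; rewrite sqr_ge0.
rewrite -(ler_pM2l HR); apply: (@le_trans _ _ (2 * P%:R * (H%:R * M))); last first.
  by rewrite mulrCA.
apply: le_trans h3.
by have -> : (H%:R * nrm S) ^+ 2 = H%:R * (nrm S ^+ 2 * H%:R) by ring.
Qed.

(** Summation by parts, leaving a boundary term and the total variation of [b]. *)
Lemma abel_le (R : realType) (J : nat) (b c : nat -> R[i]) (C : R) :
  (forall j, nrm (\sum_(i < j) c i) <= C) ->
  nrm (\sum_(j < J) b j * c j) <=
    C * (nrm (b J) + \sum_(j < J) nrm (b j.+1 - b j)).
Proof.
move=> hC; have -> : \sum_(j < J) b j * c j = b J * (\sum_(i < J) c i) -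
    \sum_(j < J) (b j.+1 - b j) * \sum_(i < j.+1) c i.
  elim: J => [|J IH]; first by rewrite !big_ord0 mulr0 subr0.
  rewrite [LHS]big_ord_recr /= IH [X in _ = _ - X]big_ord_recr /= big_ord_recr /=.
  by rewrite !(mulrBl, mulrDr, mulrDl); ring.
apply: le_trans (le_nrmB _ _) _; rewrite mulrDr lerD //.
  by rewrite Normc.normcM mulrC ler_wpM2r ?nrm_ge0.
apply: le_trans (le_nrm_sum _ _ _) _; rewrite mulr_sumr.
by apply: ler_sum => j _; rewrite Normc.normcM mulrC ler_wpM2r ?nrm_ge0.
Qed.

(** * Diophantine conditions *)

(* [z] will be a small power of the length of the sum: measuring everything in
   powers of [z] absorbs the multiplicative constants. *)
Definition dioph (R : realType) (b z : R) (M : nat) : Prop :=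
  forall (i : nat) (q k : int), q != 0 -> `|q|%:~R <= z ^+ i ->
    1 <= z ^+ (M * i + 1) * `|q%:~R * b - k%:~R|.

Lemma dioph_le (R : realType) (b z : R) (M M' : nat) : 1 <= z -> (M <= M')%N ->
  dioph b z M -> dioph b z M'.
Proof.
move=> z1 MM' h i q k q0 qi; apply: le_trans (h i q k q0 qi) _.
by rewrite ler_wpM2r // ler_weXn2l // leq_add2r leq_mul2r MM' orbT.
Qed.

(** Multiplying the defining inequality by q turns |b - k/q| into |q b - k|; irrationality excludes
    the value 0. The exponent is rounded up to a natural number, and the constant m is absorbed by
    one factor z once z >= 1/m. *)
Lemma non_liouville_dioph (R : realType) (b : R) :
  irrational b -> non_liouville b ->
  exists (C : R) (M : nat), forall z, C <= z -> dioph b z M.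
Proof.
move=> birr [m [Mr [m0 Mr1 hm]]].
pose M := Num.bound Mr; have MrM : Mr <= M%:R.
  by apply/ltW/archi_boundP; exact: le_trans Mr1.
have pos (q k : int) : 1 <= q -> m <= q%:~R ^+ M * `|q%:~R * b - k%:~R|.
  move=> q1; have qR : 1 <= q%:~R :> R by rewrite ler1z.
  have q0 : 0 < q%:~R :> R by exact: lt_le_trans qR.
  have d0 : 0 < `|b - k%:~R / q%:~R|.
    rewrite normr_gt0 subr_eq0; apply/eqP => bE; apply: birr.
    apply/rationalP; case: q q1 {qR q0} bE => // n _ ->.
    by exists k, n.
  have h : m / q%:~R `^ Mr <= `|b - k%:~R / q%:~R|.
    rewrite leNgt; apply/negP => lt; apply: hm; exists k, q.
    by rewrite q1 d0 lt.
  have -> : q%:~R * b - k%:~R = q%:~R * (b - k%:~R / q%:~R) by field; rewrite gt_eqF.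
  rewrite normrM (gtr0_norm q0).
  have hM : q%:~R `^ Mr <= q%:~R ^+ M :> R.
    by rewrite -powR_mulrn ?(ltW q0) // ler_powR.
  have p0 : 0 < q%:~R `^ Mr :> R by exact: powR_gt0.
  rewrite ler_pdivrMr // mulrC in h.
  apply: le_trans h _; rewrite ler_pM ?powR_ge0 //.
  by rewrite -[leLHS]mul1r ler_wpM2r.
exists (Num.max 1 m^-1), M => z; rewrite ge_max => /andP[z1 zm] i q k q0 qi.
have z0 : 0 < z by exact: lt_le_trans z1.
wlog q1 : q k q0 qi / 1 <= q => [H|].
  have [q1|q1] := leP 1 q; first exact: H.
  have -> : q%:~R * b - k%:~R = - ((- q)%:~R * b - (- k)%:~R) by rewrite !intrN; ring.
  rewrite normrN.
  by apply: H; rewrite ?oppr_eq0 ?normrN //; lia.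
have := pos q k q1; have qR : 1 <= q%:~R :> R by rewrite ler1z.
have {}qi : q%:~R <= z ^+ i by rewrite ger0_norm // in qi; exact: le_trans q1.
have : q%:~R ^+ M <= z ^+ (M * i).
  by rewrite mulnC exprM lerXn2r ?nnegrE ?exprn_ge0 ?(ltW z0) // (le_trans ler01).
move=> h1 h2; have d0 : 0 <= `|q%:~R * b - k%:~R| by [].
have h3 : m <= z ^+ (M * i) * `|q%:~R * b - k%:~R|.
  by apply: le_trans h2 _; exact: ler_wpM2r.
rewrite exprD expr1 mulrAC -ler_pdivrMr // mul1r.
apply: le_trans h3; rewrite -[leRHS]invrK lef_pV2 // ?posrE ?invr_gt0 //.
Qed.

(** Two such n in one block of Q consecutive integers would put their difference times b within 2 k
    of an integer, so each block contains at most one. *)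
Lemma gap_count (R : realType) (b g k : R) (Q P : nat) : (0 < Q)%N ->
  (forall d : nat, (0 < d < Q)%N -> forall l : int, 2 * k < `|d%:R * b - l%:~R|) ->
  (\sum_(n < P) `[< exists l : int, (`|b * n%:R + g - l%:~R| <= k)%R >] <= (P %/ Q).+1)%N.
Proof.
move=> Q0 gap.
pose A := [set n : 'I_P | `[< exists l : int, `|b * n%:R + g - l%:~R| <= k >]].
have -> : (\sum_(n < P) `[< exists l : int, (`|b * n%:R + g - l%:~R| <= k)%R >] = #|A|)%N.
  by rewrite -sum1_card [RHS]big_mkcond /=; apply: eq_bigr => n _; rewrite inE; case: asboolP.
have h (m n : nat) (l l' : int) : (m < n)%N -> (m %/ Q = n %/ Q)%N ->
    `|b * m%:R + g - l%:~R| <= k -> `|b * n%:R + g - l'%:~R| <= k -> False.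
  move=> mn mnQ; rewrite !ler_norml => /andP[h1 h2] /andP[h3 h4].
  have d : (0 < n - m < Q)%N.
    have := divn_eq m Q; have := divn_eq n Q; have := ltn_mod n Q; lia.
  have := gap _ d (l' - l); rewrite natrB ?(ltnW mn) // intrB.
  apply/negP; rewrite -leNgt ler_norml; apply/andP; split; lra.
have inj : {in A &, injective (fun n : 'I_P => inord (n %/ Q) : 'I_(P %/ Q).+1)}.
  move=> m n; rewrite !inE => -[l hl] [l' hl'] E.
  have {}E : (m %/ Q = n %/ Q)%N.
    have mP := ltn_ord m; have nP := ltn_ord n.
    by move/(congr1 val): E; rewrite /= !inordK // ltnS leq_div2r // ltnW.
  have [lt|lt|/val_inj //] := ltngtP m n.
    by case: (h m n l l' lt E hl hl').
  by case: (h n m l' l lt (esym E) hl' hl).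
rewrite -(card_in_imset inj).
by apply: leq_trans (max_card _) _; rewrite card_ord.
Qed.

Lemma floor_local (R : realType) (x y k : R) :
  (forall l : int, k < `|x - l%:~R|) -> `|x - y| <= k ->
  Num.floor y = Num.floor x.
Proof.
move=> far; rewrite ler_norml => /andP[h1 h2]; apply: floor_def.
have /andP[f1 f2] := floor_itv x.
have := far (Num.floor x); rewrite ger0_norm ?subr_ge0 // => h3.
have := far (Num.floor x + 1); rewrite ltr0_norm ?subr_lt0 // => h4.
by move: h4 f2; rewrite !intrD /= => h4 f2; apply/andP; split; lra.
Qed.

(** Adding two fractional parts carries 0 or 1; hence a correlation splits into at most two classes
    of n. *)
Lemma floorD_itv (R : realType) (x y : R) (k : int) :
  k = Num.floor (x + y) - Num.floor x ->
  (k = Num.floor y \/ k = Num.floor y + 1) /\ `|k%:~R - y| <= 1.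
Proof.
move=> ->; have /andP[a1 a2] := floor_itv (x + y); have /andP[b1 b2] := floor_itv x.
have /andP[c1 c2] := floor_itv y; move: a2 b2 c2; rewrite !intrD /= => a2 b2 c2.
split; last by rewrite intrN ler_norml; apply/andP; split; lra.
set p := Num.floor _ in a1 a2 *; set q := Num.floor _ in b1 b2 *.
set r := Num.floor _ in c1 c2 *.
have : p - q - r < 2 by rewrite -(ltr_int R) !intrD !intrN /=; lra.
have : -1 < p - q - r by rewrite -(ltr_int R) !intrD !intrN /=; lra.
lia.
Qed.

(** * Approximate relations from large correlations *)

Definition bracket (R : realType) (b t : R) (n : nat) : R[i] :=
  e (- t * n%:R * (Num.floor (b * n%:R))%:~R).

(* The approximate linear relations between [rho + xi], [(rho + xi) b] and [b]
   detected by a large correlation of [bracket b (rho + xi)] with its shift. *)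
Definition relation (R : realType) (b rho xi T E : R) (h : nat) : Prop :=
  exists k w l : int, [/\ `|k%:~R - b * h%:R| <= 1, `|w%:~R - xi * h%:R| <= T &
    `|rho * k%:~R + xi * k%:~R + (xi * h%:R - w%:~R) * b - l%:~R| <= E].

Lemma nrm_bracket (R : realType) (b t : R) (n : nat) : nrm (bracket b t n) = 1.
Proof. exact: nrm_e. Qed.

(** As the shift is a multiple of [D], the product of u/D with the shift is an integer and drops
    out. What remains of the floor is rewritten through the fractional part of b n. The free integer
    [y] reduces the coefficient of that fractional part modulo 1, at the price of the linear phase y
    b n. *)
Lemma corr_term (R : realType) (b xi : R) (D j n : nat) (u y k : int) :
  (0 < D)%N -> k = Num.floor (b * n%:R + b * (j * D)%:R) - Num.floor (b * n%:R) ->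
  bracket b (u%:~R / D%:R + xi) (n + j * D) *
    ((bracket b (u%:~R / D%:R + xi) n)^*)%C =
  e (- (xi * (j * D)%:R * k%:~R)) *
  (e ((- (u%:~R / D%:R * k%:~R) - xi * k%:~R - xi * (j * D)%:R * b + y%:~R * b) * n%:R) *
   e ((xi * (j * D)%:R - y%:~R) * (b * n%:R - (Num.floor (b * n%:R))%:~R))).
Proof.
move=> D0 kE; have DR : D%:R != 0 :> R by rewrite pnatr_eq0 -lt0n.
rewrite /bracket -eN -!eD; set F := Num.floor (b * n%:R) in kE *.
have -> : Num.floor (b * (n + j * D)%:R) = k + F by rewrite kE subrK natrD mulrDr.
rewrite -[RHS](eDint _ (- (y * F) - u * j%:Z * (k + F))); congr e.
rewrite !(intrD, intrN, intrM) natrD natrM.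
by field.
Qed.

(** By contraposition. For each of the two carries, the correlation is a linear phase times a
    piecewise smooth function of b n. If no relation holds, every frequency in the Fejer expansion
    of that function yields a geometric sum with ratio far from 1, so the correlation is small. *)
Lemma corr_relation (R : realType) (b z xi : R) (M P D j : nat) (u : int) :
  32 <= z -> dioph b z M -> z ^+ 4 <= P%:R -> (0 < D)%N ->
  P%:R / (16 * z ^+ 2) <= nrm (\sum_(n < P - j * D)
     bracket b (u%:~R / D%:R + xi) (n + j * D) *
       ((bracket b (u%:~R / D%:R + xi) n)^*)%C) ->
  relation b (u%:~R / D%:R) xi (z ^+ (10 * M + 20)) (z ^+ (10 * M + 20) / P%:R)
    (j * D).
Proof.
have n1 : (4 <= 5 * M + 4)%N by lia.
have n2 : (10 * M + 13 = (10 * M + 12).+1)%N by lia.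
have n3 : (3 + (5 * M + 1) = 5 * M + 4)%N by lia.
have n4 : ((10 * M + 13).+1 <= 10 * M + 20)%N by lia.
have n5 : (10 * M + 13 + 4 <= 10 * M + 20)%N by lia.
have n6 : (4 + (5 * M + 4) * 2 <= 10 * M + 12)%N by lia.
have n7 (i i' : 'I_(Num.truncn (z ^+ (10 * M + 13)))) :
    `|i%:Z - i'%:Z| <= (Num.truncn (z ^+ (10 * M + 13)))%:Z.
  by have := ltn_ord i; have := ltn_ord i'; lia.
have n8 (d : nat) : (0 < d)%N -> d%:Z != 0 by lia.
have n9 (p : int) : (p == p + 1) = false by apply/negbTE; lia.
have n10 (p : int) : (p + 1 == p) = false by apply/negbTE; lia.
move=> z32 dio zP D0 big; set K := (10 * M + 20)%N; set h := (j * D)%N.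
have z1 : 1 <= z by lra.
have z0 : 0 < z by lra.
have zX n : 0 < z ^+ n by exact: exprn_gt0.
have P0 : 0 < P%:R :> R by exact: lt_le_trans zP.
apply: contrapT => norel; set rho := u%:~R / D%:R in big norel.
have [y hy] := nearest_int (xi * h%:R); set om := xi * h%:R - y%:~R in hy.
(* Distance kept from the discontinuities. The exponent is such that multiples d b with d < [Q],
   about z^5, stay more than 2 k' from the integers; [N] below is then taken large enough for N k'^2
   >= z^4. *)
pose k' := (z ^+ (5 * M + 4))^-1; have k0 : 0 < k' by rewrite invr_gt0.
have k'le : k' <= (z ^+ 4)^-1 by rewrite lef_pV2 ?posrE // ler_weXn2l.
pose Q := Num.truncn (z ^+ 5).
have Qle : Q%:R <= z ^+ 5 by rewrite truncn_le ltW.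
have Qge : z ^+ 4 <= Q%:R.
  have := truncnS_gt (z ^+ 5); rewrite -/Q -natr1 exprS.
  have : 1 <= z ^+ 4 by rewrite exprn_ege1.
  nra.
have Q0 : (0 < Q)%N by rewrite -(ltr0n R); exact: lt_le_trans Qge.
pose N := Num.truncn (z ^+ (10 * M + 13)).
have Nle : N%:R <= z ^+ (10 * M + 13) by rewrite truncn_le ltW.
have Nge : z ^+ (10 * M + 12) <= N%:R.
  have := truncnS_gt (z ^+ (10 * M + 13)); rewrite -/N -natr1.
  rewrite n2 exprS; have : 1 <= z ^+ (10 * M + 12) by rewrite exprn_ege1.
  nra.
have N0 : (0 < N)%N by rewrite -(ltr0n R); exact: lt_le_trans Nge.
have gap (d : nat) : (0 < d < Q)%N -> forall l : int, 2 * k' < `|d%:R * b - l%:~R|.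
  move=> /andP[d0 dQ] l; have := @dio 5%N d%:Z l.
  have dz : d%:R <= z ^+ 5 by apply: le_trans Qle; rewrite ler_nat ltnW.
  move=> /(_ (n8 d d0) dz); rewrite [_%:~R * b]/(d%:R * b) mulnC => hd.
  have -> : k' = (z ^+ 3)^-1 / z ^+ (5 * M + 1).
    by rewrite -invfM -exprD n3.
  rewrite mulrA ltr_pdivrMr // [ltRHS]mulrC; apply: lt_le_trans hd.
  have : z <= z ^+ 3 by rewrite -[leLHS]expr1 ler_weXn2l.
  by move=> ?; rewrite ltr_pdivrMr ?mul1r //; lra.
(* Points near a jump of floor(x) or of floor(x + b h); the summand 0 matches the shape of
   [gap_count]. *)
pose bad (x : R) : bool := `[< exists l : int, `|x + 0 - l%:~R| <= k' >] ||
                           `[< exists l : int, `|x + b * h%:R - l%:~R| <= k' >].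
pose G (k : int) (x : R) : R[i] :=
  if Num.floor (x + b * h%:R) - Num.floor x == k
  then e (om * (x - (Num.floor x)%:~R)) else 0.
pose A (k : int) : R := - (rho * k%:~R) - xi * k%:~R - xi * h%:R * b + y%:~R * b.
pose J := (P - h)%N.
have JP : J%:R <= P%:R :> R by rewrite ler_nat leq_subr.
pose B := 2 * P%:R / z ^+ K.
have B0 : 0 < B by rewrite divr_gt0 // mulr_gt0.
pose k1 := Num.floor (b * h%:R).
have each (k : int) : k = k1 \/ k = k1 + 1 ->
    nrm (\sum_(n < J) e (A k * n%:R) * G k (b * n%:R)) <= 26 * (P%:R / z ^+ 4).
  move=> kk1.
  have hk : `|k%:~R - b * h%:R| <= 1.
    have := floor_itv (b * h%:R); rewrite intrD -/k1 => /andP[].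
    by case: kk1 => ->; clear; rewrite ?intrD ler_norml => f1 f2;
      apply/andP; split; lra.
  (* Away from the jumps G varies by at most 16 |om| k', and |om| <= 1/2 gives 8 k'. *)
  have F1 := @fejer_approx R N J (fun n => e (A k * n%:R)) (fun n => b * n%:R)
    (G k) bad k' (8 * k') B N0 k0.
  apply: le_trans (F1 _ _ _ _ _ _ (ltW B0)) _.
  - by rewrite mulr_ge0 // ltW.
  - by move=> n; rewrite nrm_e.
  - by move=> x; rewrite /G; case: ifP => _; rewrite ?nrm_e ?nrm0.
  - move=> x l; rewrite /G.
    have -> : x + l%:~R + b * h%:R = x + b * h%:R + l%:~R by ring.
    have fl (p : R) : Num.floor (p + l%:~R) = Num.floor p + l.
      by rewrite floorDrz ?intr_int // intrKfloor.
    rewrite !fl.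
    have -> : Num.floor (x + b * h%:R) + l - (Num.floor x + l) =
      Num.floor (x + b * h%:R) - Num.floor x by ring.
    by case: ifP => // _; congr e; rewrite intrD; ring.
  - move=> x x' /norP[/asboolP b1 /asboolP b2] xx'.
    have E1 : Num.floor x' = Num.floor x.
      apply: (floor_local (k := k')) => // l; rewrite ltNge; apply/negP => hl.
      by apply: b1; exists l; rewrite addr0.
    have E2 : Num.floor (x' + b * h%:R) = Num.floor (x + b * h%:R).
      apply: (floor_local (k := k')) => [l|].
        by rewrite ltNge; apply/negP => hl; apply: b2; exists l.
      by rewrite opprD addrACA subrr addr0.
    rewrite /G E1 E2; case: ifP => _; last by rewrite subrr nrm0 mulr_ge0 // ltW.
    apply: le_trans (e_lip _ _) _.
    rewrite -mulrBr opprB addrA subrK normrM.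
    have := ler_pM (normr_ge0 om) (normr_ge0 (x - x')) hy xx'; lra.
  (* A large sum at frequency m would put A k + m b close to an integer, which is the excluded
     relation with w = y + m. *)
  - move=> i i'; right; set m := (i%:Z - i'%:Z).
    have [l hl] := geom_e (A k + m%:~R * b) J.
    under eq_bigr => n _ do rewrite -eD.
    rewrite (_ : \sum_(n < J) _ = \sum_(n < J) e ((A k + m%:~R * b) * n%:R)); last first.
      by apply: eq_bigr => n _; congr e; ring.
    rewrite leNgt; apply/negP => lt; apply: norel.
    exists k, (y + m), (- l); split => //.
      have : `|m%:~R : R| <= N%:R.
        rewrite -intr_norm -[N%:R]/((N%:Z)%:~R) ler_int.
        exact: n7.
      have -> : (y + m)%:~R - xi * h%:R = m%:~R - om by rewrite intrD /om; ring.
      move=> hm; apply: le_trans (ler_normB _ _) _.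
      have : z ^+ (10 * M + 13).+1 <= z ^+ K by rewrite ler_weXn2l.
      have := zX (10 * M + 13)%N; have : 1 <= z ^+ (10 * M + 13) by rewrite exprn_ege1.
      rewrite exprS; nra.
    have -> : rho * k%:~R + xi * k%:~R + (xi * h%:R - (y + m)%:~R) * b - (- l)%:~R =
        - (A k + m%:~R * b - l%:~R).
      by rewrite /A intrD intrN; ring.
    rewrite normrN.
    have : `|A k + m%:~R * b - l%:~R| * B <= 2.
      by apply: le_trans hl; rewrite ler_wpM2l // ltW.
    rewrite -ler_pdivlMr // => /le_trans; apply.
    by rewrite /B le_eqVlt; apply/orP; left; apply/eqP; field; rewrite !gt_eqF.
  have h1 : N%:R * B <= 2 * (P%:R / z ^+ 4).
    have -> : N%:R * B = 2 * P%:R * (N%:R / z ^+ K) by rewrite /B; field; rewrite gt_eqF.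
    rewrite -mulrA ler_pM2l // ler_pM2l //.
    rewrite ler_pdivrMr // mulrC ler_pdivlMr //.
    apply: le_trans (ler_wpM2r (ltW (zX 4%N)) Nle) _.
    by rewrite -exprD ler_weXn2l.
  have h2 : J%:R * (8 * k' + 8 / (N%:R * k' ^+ 2)) <= 16 * (P%:R / z ^+ 4).
    have q : (N%:R * k' ^+ 2)^-1 <= (z ^+ 4)^-1.
      rewrite lef_pV2 ?posrE ?mulr_gt0 ?exprn_gt0 ?ltr0n //.
      rewrite /k' exprVn -exprM ler_pdivlMr // -exprD.
      by apply: le_trans Nge; rewrite ler_weXn2l.
    have : 8 * k' + 8 / (N%:R * k' ^+ 2) <= 16 * (z ^+ 4)^-1 by lra.
    have p0 : 0 <= 8 * k' + 8 / (N%:R * k' ^+ 2).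
      by apply: addr_ge0; [rewrite mulr_ge0 // ltW | rewrite divr_ge0 // mulr_ge0 ?sqr_ge0].
    move=> /(ler_pM (ler0n R J) p0 JP); lra.
  have h3 : 2 * (\sum_(n < J) bad (b * n%:R)%R)%:R <= 8 * (P%:R / z ^+ 4).
    have c1 := @gap_count R b 0 k' Q J Q0 gap.
    have c2 := @gap_count R b (b * h%:R) k' Q J Q0 gap.
    have c3 : (\sum_(n < J) bad (b * n%:R)%R <= 2 * (J %/ Q).+1)%N.
      rewrite mul2n -addnn; apply: leq_trans (leq_add c1 c2).
      rewrite -big_split /=; apply: leq_sum => n _; rewrite /bad.
      by case: (`[< _ >]); case: (`[< _ >]).
    have c4 : (J %/ Q)%:R <= P%:R / z ^+ 4.
      rewrite ler_pdivlMr //; apply: le_trans (ler_wpM2l (ler0n R _) Qge) _.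
      by rewrite -natrM; apply: le_trans JP; rewrite ler_nat leq_divM.
    have c5 : 1 <= P%:R / z ^+ 4 by rewrite ler_pdivlMr // mul1r.
    have : (\sum_(n < J) bad (b * n%:R)%R)%:R <= 2 * ((J %/ Q)%:R + 1) :> R.
      by rewrite natr1 -natrM ler_nat.
    lra.
  lra.
have : nrm (\sum_(n < J) bracket b (rho + xi) (n + h) *
    ((bracket b (rho + xi) n)^*)%C) <= 52 * (P%:R / z ^+ 4).
  pose c k := e (- (xi * h%:R * k%:~R)).
  have -> : \sum_(n < J) bracket b (rho + xi) (n + h) *
      ((bracket b (rho + xi) n)^*)%C =
      c k1 * (\sum_(n < J) e (A k1 * n%:R) * G k1 (b * n%:R)) +
      c (k1 + 1) * (\sum_(n < J) e (A (k1 + 1) * n%:R) * G (k1 + 1) (b * n%:R)).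
    rewrite !mulr_sumr -big_split /=; apply: eq_bigr => n _.
    set k := Num.floor (b * n%:R + b * h%:R) - Num.floor (b * n%:R).
    rewrite (@corr_term R b xi D j n u y k D0 erefl) -/h -/rho -/(A k) -/om.
    rewrite /G -/k; have [[->|->] _] := floorD_itv (erefl k).
      by rewrite -/k1 eqxx n9 !mulr0 addr0.
    by rewrite -/k1 eqxx n10 !mulr0 add0r.
  apply: le_trans (le_nrmD _ _) _; rewrite !Normc.normcM !nrm_e !mul1r.
  have := each k1 (or_introl erefl); have := each (k1 + 1) (or_intror erefl); lra.
(* The contradiction is numerical: 16 * 52 = 832 is less than 32^2 <= z^2. *)
move=> le; have := le_trans big le; apply/negP; rewrite -ltNge.
rewrite mulrA ltr_pdivrMr // mulrAC ltr_pdivlMr ?mulr_gt0 //.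
have -> : 52 * P%:R * (16 * z ^+ 2) = P%:R * z ^+ 2 * 832 by ring.
have -> : P%:R * z ^+ 4 = P%:R * z ^+ 2 * z ^+ 2 by ring.
rewrite ltr_pM2l ?mulr_gt0 // expr2; nra.
Qed.

(** In van der Corput's inequality the shifts outside the set contribute at most P / (16 z^2) each,
    and those inside at most P. After the terms in H are collected, H <= 16 z^2 #|G| remains, and 16
    <= z. *)
Lemma many_relations (R : realType) (b z xi : R) (M P D H : nat) (u : int) :
  32 <= z -> dioph b z M -> z ^+ 4 <= P%:R -> (0 < D)%N -> (H * D <= P)%N ->
  4 * z ^+ 2 <= H%:R ->
  P%:R / z <= nrm (\sum_(n < P) bracket b (u%:~R / D%:R + xi) n) ->
  H%:R <= z ^+ 3 * #|[set j : 'I_H | (0 < j)%N &&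
    `[< relation b (u%:~R / D%:R) xi (z ^+ (10 * M + 20))
          (z ^+ (10 * M + 20) / P%:R) (j * D) >]]|%:R.
Proof.
move=> z32 dio zP D0 HDP zH big; set G := [set j | _].
have z0 : 0 < z by lra.
have z20 : 0 < z ^+ 2 by exact: exprn_gt0.
have P0 : 0 < P%:R :> R by apply: lt_le_trans zP; exact: exprn_gt0.
pose a := bracket b (u%:~R / D%:R + xi).
pose tau j := nrm (\sum_(n < P - j * D) a (n + j * D)%N * ((a n)^*)%C).
have tauP j : tau j <= P%:R.
  apply: le_trans (le_nrm_sum _ _ _) _.
  apply: (@le_trans _ _ (\sum_(n < P - j * D) 1)).
    by apply: ler_sum => n _; rewrite Normc.normcM nrmC !nrm_bracket mulr1.
  by rewrite sumr_const card_ord ler_nat leq_subr.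
have ha n : nrm (a n) <= 1 by rewrite nrm_bracket.
have W := vdC HDP ha; rewrite -/(tau _) in W.
have S1 : \sum_(1 <= j < H) tau j <=
    #|G|%:R * P%:R + H%:R * (P%:R / (16 * z ^+ 2)).
  have q0 : 0 <= P%:R / (16 * z ^+ 2) by rewrite divr_ge0 // mulr_ge0 // ltW.
  apply: (@le_trans _ _ (\sum_(j < H) (if j \in G then P%:R else 0) +
      \sum_(j < H) P%:R / (16 * z ^+ 2))); last first.
    rewrite sumr_const card_ord [_ * (P%:R / _)]mulr_natl lerD2r.
    by rewrite -big_mkcond /= sumr_const mulr_natl.
  rewrite -big_split /= big_geq_mkord /= big_mkcond /=.
  apply: ler_sum => j _; case: ifP => [j0|_]; last first.
    by rewrite addr_ge0 //; case: ifP.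
  case: ifP => [_|jG]; first by rewrite -[leLHS]addr0 lerD // tauP.
  rewrite add0r leNgt; apply/negP => lt; move/negP: jG; apply.
  rewrite inE j0; apply/asboolP; apply: corr_relation => //.
  exact: ltW lt.
have sq : (P%:R / z) ^+ 2 * H%:R <= nrm (\sum_(n < P) a n) ^+ 2 * H%:R.
  by rewrite ler_wpM2r // ler_sqr ?nnegrE ?nrm_ge0 ?divr_ge0 // ltW.
have X := le_trans sq W.
have {X} : P%:R * (H%:R / z ^+ 2) * P%:R <=
    P%:R * (2 * (1 + 2 * #|G|%:R + 2 * H%:R / (16 * z ^+ 2))) * P%:R.
  have -> : P%:R * (H%:R / z ^+ 2) * P%:R = (P%:R / z) ^+ 2 * H%:R.
    by field; rewrite gt_eqF.
  apply: le_trans X _.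
  have -> : P%:R * (2 * (1 + 2 * #|G|%:R + 2 * H%:R / (16 * z ^+ 2))) * P%:R =
    2 * P%:R * (P%:R + 2 * (#|G|%:R * P%:R + H%:R * (P%:R / (16 * z ^+ 2)))).
    by field; rewrite gt_eqF.
  by rewrite ler_wpM2l ?mulr_ge0 // lerD2l ler_wpM2l.
rewrite ler_pM2r // ler_pM2l // ler_pdivrMr //.
have -> : 2 * (1 + 2 * #|G|%:R + 2 * H%:R / (16 * z ^+ 2)) * z ^+ 2 =
    2 * z ^+ 2 + 4 * (z ^+ 2 * #|G|%:R) + H%:R / 4 by field; rewrite gt_eqF.
have -> : z ^+ 3 * #|G|%:R = z * (z ^+ 2 * #|G|%:R) by ring.
have : 32 * (z ^+ 2 * #|G|%:R) <= z * (z ^+ 2 * #|G|%:R).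
  by rewrite ler_wpM2r // mulr_ge0 // ltW.
have : 0 <= z ^+ 2 * #|G|%:R by rewrite mulr_ge0 // ltW.
move: zH; clear; lra.
Qed.

(** Distinct positive indices cannot all lie below their number. *)
Lemma large_member (H : nat) (G : {set 'I_H}) :
  (forall j, j \in G -> 0 < j)%N -> (0 < #|G|)%N ->
  exists2 j, j \in G & (#|G| <= j)%N.
Proof.
move=> G0 Gn; apply: contrapT => far.
have small j : j \in G -> (j < #|G|)%N.
  by move=> jG; rewrite ltnNge; apply/negP => le; apply: far; exists j.
have : (#|G| <= #|G|.-1)%N; last by rewrite leqNgt prednK // leqnn.
have E : (#|G|.-1).+1 = #|G| by rewrite prednK.
have inj : {in G &, injective (fun j : 'I_H => inord j : 'I_(#|G|.-1).+1)}.
  move=> i j iG jG /(congr1 val); rewrite /= !inordK ?E ?small //.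
  exact: val_inj.
rewrite -{1}(card_in_imset inj).
have sub : (fun j : 'I_H => inord j : 'I_(#|G|.-1).+1) @: G \subset [set~ ord0].
  apply/fintype.subsetP => _ /imsetP[j jG ->]; rewrite !inE -val_eqE /= inordK ?E ?small //.
  by rewrite -lt0n G0.
by apply: leq_trans (subset_leq_card sub) _; rewrite cardsC1 card_ord.
Qed.

(** If all pairs (k j, j) were proportional, the difference (p, q) of two close members would have
    the same slope as (k m, m) for a large member m. Then |q b - p| <= q / m with q small, against
    the Diophantine condition. *)
Lemma nonparallel (R : realType) (b z : R) (M H : nat) (G : {set 'I_H})
    (k : 'I_H -> int) :
  32 <= z -> dioph b z M -> (forall j, j \in G -> 0 < j)%N ->
  (forall j, j \in G -> `|(k j)%:~R - b * j%:R| <= 1) ->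
  H%:R <= z ^+ 3 * #|G|%:R -> z ^+ (4 * M + 9) <= H%:R ->
  exists i j, [/\ i \in G, j \in G & k i * j%:Z != k j * i%:Z].
Proof.
have n2 : (4 * M + 9 = (4 * M + 1) + 4 + 3 + 1)%N by lia.
move=> z32 dio G0 hk HG zH.
have z0 : 0 < z by lra.
have z1 : 1 <= z by lra.
have zX n : 0 < z ^+ n by exact: exprn_gt0.
have Hz9 : z ^+ 9 <= H%:R.
  by apply: le_trans zH; rewrite ler_weXn2l // leq_addl.
have G1 : (0 < #|G|)%N.
  rewrite -(ltr0n R) -(pmulr_rgt0 _ (zX 3%N)); apply: lt_le_trans HG.
  exact: lt_le_trans Hz9.
apply: contrapT => par.
have parE i j : i \in G -> j \in G -> k i * j%:Z = k j * i%:Z.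
  move=> iG jG; apply/eqP; apply: contrapT => /negP ne; apply: par.
  by exists i, j.
pose Q := Num.truncn (z ^+ 4).
have Qle : Q%:R <= z ^+ 4 by rewrite truncn_le ltW.
have z3ge : 1024 <= z ^+ 3.
  have : 32 * 32 <= z * z by apply: ler_pM => //; lra.
  have -> : z ^+ 3 = z * (z * z) by ring.
  nra.
have Qge : 8 * z ^+ 3 <= Q%:R.
  have := truncnS_gt (z ^+ 4); rewrite -/Q -natr1.
  have -> : z ^+ 4 = z * z ^+ 3 by ring.
  nra.
have Q0 : (0 < Q)%N by rewrite -(ltr0n R); apply: lt_le_trans Qge; rewrite mulr_gt0.
(* The density of G is at least 1 / z^3 and Q is about z^4, so some block of length Q contains two
   members. *)
have [i [j [iG jG ij ijQ]]] : exists i j, [/\ i \in G, j \in G, (i < j)%N & (j - i <= Q)%N].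
  apply: contrapT => none.
  have h (i j : 'I_H) : i \in G -> j \in G -> (i %/ Q = j %/ Q)%N -> (i < j)%N -> False.
    move=> iG jG E lt; apply: none; exists i, j; split => //.
    by have := divn_eq i Q; have := divn_eq j Q; have := ltn_mod j Q; clear -E Q0; lia.
  have inj : {in G &, injective (fun i : 'I_H => inord (i %/ Q) : 'I_(H %/ Q).+1)}.
    move=> i j iG jG /(congr1 val); rewrite /= !inordK; last 2 first.
    - by rewrite ltnS leq_div2r // ltnW.
    - by rewrite ltnS leq_div2r // ltnW.
    move=> E; have [lt|lt|/val_inj //] := ltngtP i j.
      by case: (h i j iG jG E lt).
    by case: (h j i jG iG (esym E) lt).
  have : (#|G| <= (H %/ Q).+1)%N.
    rewrite -(card_in_imset inj); apply: leq_trans (max_card _) _.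
    by rewrite card_ord.
  rewrite -(ler_nat R) -natr1 => le.
  have dQ : (H %/ Q)%:R * Q%:R <= H%:R :> R by rewrite -natrM ler_nat leq_divM.
  have : (H %/ Q)%:R * (8 * z ^+ 3) <= H%:R.
    by apply: le_trans dQ; rewrite ler_wpM2l.
  have := ler_wpM2l (ltW (zX 3%N)) le.
  have : z ^+ 3 * 1024 <= H%:R.
    apply: le_trans Hz9; have -> : z ^+ 9 = z ^+ 3 * z ^+ 6 by ring.
    rewrite ler_pM2l //; apply: le_trans z3ge _; exact: ler_weXn2l.
  have := zX 3%N; move: HG; clear; set y := z ^+ 3; lra.
have [m mG Gm] := large_member G0 G1.
set q := (j - i)%N in ijQ; set p := k j - k i.
have E : p * m%:Z = k m * q%:Z.
  have := parE i m iG mG; have := parE j m jG mG.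
  rewrite /p /q mulrBl => -> ->; rewrite -mulrBr subzn // ltnW //.
have qz : `|q%:Z|%:~R <= z ^+ 4.
  by apply: le_trans Qle; rewrite [leLHS]/(q%:R) ler_nat.
have q0 : q%:Z != 0 by rewrite /q; clear -ij; lia.
have := dio 4%N q%:Z p q0 qz.
have m0 : 0 < m%:R :> R by rewrite ltr0n G0.
have hm : `|q%:R * b - p%:~R| * m%:R <= q%:R.
  rewrite -{1}(ger0_norm (ltW m0)) -normrM mulrBl.
  have -> : p%:~R * m%:R = (k m)%:~R * q%:R :> R.
    by rewrite -[m%:R]/((m%:Z)%:~R) -intrM E intrM.
  have -> : q%:R * b * m%:R - (k m)%:~R * q%:R = - (q%:R * ((k m)%:~R - b * m%:R)).
    ring.
  by rewrite normrN normrM ger0_norm // ler_piMr // hk.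
apply/negP; rewrite -ltNge [_%:~R * b]/(q%:R * b) [(M * 4)%N]mulnC.
rewrite -(ltr_pM2r m0) mul1r -mulrA.
apply: le_lt_trans (ler_wpM2l (ltW (zX _)) hm) _.
have h1 : z ^+ (4 * M + 1) * q%:R <= z ^+ (4 * M + 1 + 4).
  by rewrite [leRHS]exprD ler_pM2l //; apply: le_trans Qle; rewrite ler_nat.
apply: le_lt_trans h1 _; rewrite -(ltr_pM2r (zX 3%N)) -exprD.
have h2 : z ^+ (4 * M + 1 + 4 + 3) < H%:R.
  apply: lt_le_trans zH; rewrite n2 [ltRHS]exprD expr1 ltr_pMr //; lra.
apply: lt_le_trans h2 _; apply: le_trans HG _; rewrite mulrC ler_wpM2r ?ler_nat //.
exact: ltW.
Qed.

(** * Rational approximation of the frequency *)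

(** The case u = 0, D = 1, with all of the frequency in [xi]; the witnesses are collected into
    functions of the shift. *)
Lemma many_relations1 (R : realType) (b z t : R) (M P H : nat) :
  32 <= z -> dioph b z M -> z ^+ 4 <= P%:R -> (H <= P)%N ->
  4 * z ^+ 2 <= H%:R -> P%:R / z <= nrm (\sum_(n < P) bracket b t n) ->
  exists (G : {set 'I_H}) (k w l : 'I_H -> int),
    [/\ H%:R <= z ^+ 3 * #|G|%:R, forall j, j \in G -> (0 < j)%N &
    forall j, j \in G -> [/\ `|(k j)%:~R - b * j%:R| <= 1,
      `|(w j)%:~R - t * j%:R| <= z ^+ (10 * M + 20) &
      `|t * (k j)%:~R + (t * j%:R - (w j)%:~R) * b - (l j)%:~R|
         <= z ^+ (10 * M + 20) / P%:R]].
Proof.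
move=> z32 dio zP HP zH big.
have tE : t = (0 : int)%:~R / 1%:R + t by rewrite mul0r add0r.
have HP1 : (H * 1 <= P)%N by rewrite muln1.
rewrite tE in big; have := many_relations z32 dio zP (ltnSn 0) HP1 zH big.
set G := [set j | _] => HG.
have rel (j : 'I_H) : exists s : int * int * int, j \in G ->
    [/\ `|s.1.1%:~R - b * j%:R| <= 1, `|s.1.2%:~R - t * j%:R| <= z ^+ (10 * M + 20) &
    `|t * s.1.1%:~R + (t * j%:R - s.1.2%:~R) * b - s.2%:~R|
         <= z ^+ (10 * M + 20) / P%:R].
  have [|jG] := boolP (j \in G); last by exists (0, 0, 0).
  rewrite inE => /andP[_ /asboolP[k [w [l]]]]; rewrite muln1 mul0r mul0r add0r => h.
  by exists (k, w, l).
have [f hf] := choice rel.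
exists G, (fun j => (f j).1.1), (fun j => (f j).1.2), (fun j => (f j).2); split => //.
by move=> j; rewrite inE => /andP[].
Qed.

Lemma pigeonhole_int (H V : nat) (G : {set 'I_H}) (m : 'I_H -> int) :
  (forall j, j \in G -> `|m j| <= V%:Z) -> (2 * V + 1 < #|G|)%N ->
  exists i j, [/\ i \in G, j \in G, (i < j)%N & m i = m j].
Proof.
move=> mV VG; apply: contrapT => none.
have none' i j : i \in G -> j \in G -> m i = m j -> (i < j)%N -> False.
  by move=> iG jG E ij; apply: none; exists i, j.
have inj : {in G &, injective (fun j : 'I_H => inord (absz (m j + V%:Z)) : 'I_(2 * V).+1)}.
  move=> i j iG jG /(congr1 val); have := mV i iG; have := mV j jG => hi hj.
  rewrite /= !inordK; [|by clear -hi; lia|by clear -hj; lia] => E.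
  have {}E : m i = m j by clear -E hi hj; lia.
  have [lt|lt|/val_inj //] := ltngtP i j.
    by case: (none' i j iG jG E lt).
  by case: (none' j i jG iG (esym E) lt).
move: VG; rewrite ltnNge -(card_in_imset inj) => /negP; apply.
by apply: leq_trans (max_card _) _; rewrite card_ord addn1.
Qed.

(** Supplies integer parameters of prescribed size: truncation costs at most one factor z. *)
Lemma truncn_pow (R : realType) (z : R) (a : nat) : 32 <= z ->
  z ^+ a <= (Num.truncn (z ^+ a.+1))%:R <= z ^+ a.+1.
Proof.
move=> z32; have z1 : 1 <= z by lra.
rewrite truncn_le exprn_ge0 ?andbT; last by lra.
have := truncnS_gt (z ^+ a.+1); rewrite -natr1 exprS.
have : 1 <= z ^+ a by exact: exprn_ege1.
nra.
Qed.

Lemma pow_absorb (R : realType) (z x : R) (a : nat) : 32 <= z ->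
  0 <= x -> x <= 32 -> x * z ^+ a <= z ^+ a.+1.
Proof.
move=> z32 x0 x32; rewrite exprS ler_wpM2r ?exprn_ge0 //; lra.
Qed.

(** Multiply the relation for i by j, that for j by i, and subtract: the terms t i j b cancel. The
    determinant k i * j - k j * i becomes D, and it is nonzero by [nonparallel]. *)
Lemma linear_approx (R : realType) (b z t : R) (M P : nat) :
  32 <= z -> dioph b z M -> z ^+ (4 * M + 10) <= P%:R ->
  P%:R / z <= nrm (\sum_(n < P) bracket b t n) ->
  exists D u v : int, [/\ D != 0, `|D|%:~R <= 2 * z ^+ (4 * M + 10),
    `|v|%:~R <= 2 * z ^+ (4 * M + 10) * z ^+ (10 * M + 20) &
    `|t * D%:~R - u%:~R - b * v%:~R| <=
      2 * z ^+ (4 * M + 10) * (z ^+ (10 * M + 20) / P%:R)].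
Proof.
have n1 : (4 * M + 10 = (4 * M + 9).+1)%N by lia.
have n2 : (4 <= 4 * M + 9)%N by lia.
rewrite n1; move=> z32 dio zP big; set E := z ^+ _ / P%:R; set T := z ^+ (10 * M + 20).
have z0 : 0 < z by lra.
have z1 : 1 <= z by lra.
have := truncn_pow (4 * M + 9) z32; set Z := z ^+ (4 * M + 9).+1 in zP *.
set H := Num.truncn Z => /andP[Hge Hle].
have HP : (H <= P)%N by rewrite -(ler_nat R) (le_trans Hle).
have z4H : z ^+ 4 <= H%:R by apply: le_trans Hge; exact: ler_weXn2l.
have zP4 : z ^+ 4 <= P%:R by apply: le_trans z4H _; rewrite ler_nat.
have zH : 4 * z ^+ 2 <= H%:R.
  apply: le_trans z4H; have -> : z ^+ 4 = z ^+ 2 * z ^+ 2 by ring.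
  by rewrite ler_pM2r ?exprn_gt0 // expr2; nra.
have [G [k [w [l [HG G0 rel]]]]] := many_relations1 z32 dio zP4 HP zH big.
have hk j : j \in G -> `|(k j)%:~R - b * j%:R| <= 1 by move=> /rel[].
have [i [j [iG jG ne]]] := nonparallel z32 dio G0 hk HG Hge.
have [ki wi li] := rel i iG; have [kj wj lj] := rel j jG.
have T0 : 0 <= T by rewrite exprn_ge0 // ltW.
have E0 : 0 <= E by rewrite divr_ge0 ?ler0n.
have H0 (p : 'I_H) : (p%:R : R) <= Z.
  by apply: le_trans Hle; rewrite ler_nat ltnW.
have cross (x y c : R) : 0 <= c -> `|x| <= c -> `|y| <= c ->
    `|x * j%:R - y * i%:R| <= 2 * Z * c.
  move=> c0 hx hy; apply: le_trans (ler_normB _ _) _.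
  rewrite !normrM !normr_nat.
  have := ler_pM (normr_ge0 x) (ler0n R j) hx (H0 j).
  have := ler_pM (normr_ge0 y) (ler0n R i) hy (H0 i).
  by clear; lra.
exists (k i * j%:Z - k j * i%:Z), (l i * j%:Z - l j * i%:Z), (w i * j%:Z - w j * i%:Z).
have ij p q : (p * j%:Z - q * i%:Z)%:~R = p%:~R * j%:R - q%:~R * i%:R :> R.
  by rewrite intrB !intrM.
split; first by rewrite subr_eq0.
- rewrite intr_norm ij.
  have -> : (k i)%:~R * j%:R - (k j)%:~R * i%:R =
    ((k i)%:~R - b * i%:R) * j%:R - ((k j)%:~R - b * j%:R) * i%:R by ring.
  by apply: le_trans (cross _ _ 1 _ ki kj) _; rewrite ?mulr1.
- rewrite intr_norm ij.
  have -> : (w i)%:~R * j%:R - (w j)%:~R * i%:R =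
    ((w i)%:~R - t * i%:R) * j%:R - ((w j)%:~R - t * j%:R) * i%:R by ring.
  exact: cross.
rewrite !ij; have -> : t * ((k i)%:~R * j%:R - (k j)%:~R * i%:R) -
    ((l i)%:~R * j%:R - (l j)%:~R * i%:R) -
    b * ((w i)%:~R * j%:R - (w j)%:~R * i%:R) =
  (t * (k i)%:~R + (t * i%:R - (w i)%:~R) * b - (l i)%:~R) * j%:R -
  (t * (k j)%:~R + (t * j%:R - (w j)%:~R) * b - (l j)%:~R) * i%:R by ring.
exact: cross.
Qed.

(** Substituting t D = u + b v + eps into the relations of a longer range of shifts leaves a
    combination of 1, b and b^2 with integer coefficients. The coefficient [m j] of b takes few
    values, so two shifts share it, and subtracting leaves v (j - i) b^2 near an integer. The
    condition on b^2 then forces v = 0. *)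
Lemma rational_approx (R : realType) (b z t : R) (M P : nat) :
  32 <= z -> `|b| + 1 <= z -> dioph b z M -> dioph (b ^+ 2) z M ->
  z ^+ (M * (28 * M + 68) + 28 * M + 80) <= P%:R ->
  P%:R / z <= nrm (\sum_(n < P) bracket b t n) ->
  exists (D : nat) (u : int), [/\ (0 < D)%N, D%:R <= z ^+ (4 * M + 11) &
    `|t - u%:~R / D%:R| <= z ^+ (14 * M + 31) / P%:R].
Proof.
set A := (M * (28 * M + 68) + 28 * M + 80)%N.
have m1 : (14 * M + 37 = (14 * M + 36).+1)%N by lia.
have m2 : (4 * M + 10 <= A)%N by rewrite /A; nia.
have m3 : (14 * M + 37 <= A)%N by rewrite /A; nia.
have m4 : (4 <= 14 * M + 36)%N by lia.
have m5 : (14 * M + 31 = (4 * M + 10 + (10 * M + 20)).+1)%N by lia.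
have m6 : ((14 * M + 31 + 1) + 3 + 1 = 14 * M + 36)%N by lia.
have m7 : (28 * M + 68 = 4 * M + 10 + (10 * M + 20) + (14 * M + 37) + 1)%N by lia.
have m8 : (M * (28 * M + 68) + 1 + (4 * M + 10 + (10 * M + 20) + (14 * M + 37) + 3) + 1
   <= A)%N by rewrite /A; lia.
have m9 : (4 * M + 11 = (4 * M + 10).+1)%N by lia.
move: m2 m3 m4 m5 m6 m7 m8 m9; rewrite m1; clearbody A.
set a := (4 * M + 10)%N; set K := (10 * M + 20)%N => m2 m3 m4 m5 m6 m7 m8 m9.
move=> z32 bz dio dio2 zA big.
have z0 : 0 < z by lra.
have z1 : 1 <= z by lra.
have zX n : 0 < z ^+ n by exact: exprn_gt0.
have zle m n : (m <= n)%N -> z ^+ m <= z ^+ n by exact: ler_weXn2l.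
have P0 : 0 < P%:R :> R by exact: lt_le_trans zA.
have zaP : z ^+ a <= P%:R by apply: le_trans zA; exact: zle.
have [D [u [v [D0 Da va hD]]]] := linear_approx z32 dio zaP big.
set E := z ^+ K / P%:R in hD.
have E0 : 0 <= E by rewrite divr_ge0 ?ltW.
have := truncn_pow (14 * M + 36) z32; set Z := z ^+ (14 * M + 36).+1.
set H := Num.truncn Z => /andP[Hge Hle].
have ZP : Z <= P%:R by apply: le_trans zA; exact: zle.
have Z0 : 0 < Z by exact: zX.
have HP : (H <= P)%N by rewrite -(ler_nat R) (le_trans Hle).
have z4H : z ^+ 4 <= H%:R by apply: le_trans Hge; exact: zle.
have zP4 : z ^+ 4 <= P%:R by apply: le_trans z4H _; rewrite ler_nat.
have zH : 4 * z ^+ 2 <= H%:R.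
  apply: le_trans z4H; have -> : z ^+ 4 = z ^+ 2 * z ^+ 2 by ring.
  by rewrite ler_pM2r ?exprn_gt0 // expr2; nra.
have [G [k [w [l [HG G0 rel]]]]] := many_relations1 z32 dio zP4 HP zH big.
have HZ (p : 'I_H) : (p%:R : R) <= Z.
  by apply: le_trans Hle; rewrite ler_nat ltnW.
set eps := t * D%:~R - u%:~R - b * v%:~R in hD.
(* This integer equals v (k j - b j) - eps j - D (w j - t j), three terms that are all bounded by
   powers of z independent of P. *)
pose m (j : 'I_H) := v * k j + u * j%:Z - D * w j.
pose V := Num.truncn (z ^+ (14 * M + 31)).
have mV j : j \in G -> `|m j| <= V%:Z.
  move=> jG; have [kj wj lj] := rel j jG.
  suff : `|(m j)%:~R : R| <= z ^+ (14 * M + 31).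
    rewrite -intr_norm -abszE -[(_%:Z)%:~R]/(`|m j|%N%:R) => h.
    by rewrite lez_nat truncn_ge_nat // ltW.
  have -> : (m j)%:~R = v%:~R * ((k j)%:~R - b * j%:R) - eps * j%:R -
      D%:~R * ((w j)%:~R - t * j%:R).
    by rewrite /m !(intrB, intrD, intrM) /eps; ring.
  have x1 : `|v%:~R * ((k j)%:~R - b * j%:R)| <= 2 * z ^+ a * z ^+ K.
    by rewrite normrM -intr_norm -[leRHS]mulr1 ler_pM.
  have x2 : `|eps * j%:R| <= 2 * z ^+ a * z ^+ K.
    rewrite normrM normr_nat; apply: le_trans (ler_pM _ _ hD (HZ j)) _ => //.
    have EZ : E * Z <= z ^+ K by rewrite /E mulrAC ler_pdivrMr // ler_pM2l.
    by rewrite -(mulrA _ E Z) ler_pM2l // mulr_gt0.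
  have x3 : `|D%:~R * ((w j)%:~R - t * j%:R)| <= 2 * z ^+ a * z ^+ K.
    by rewrite normrM -intr_norm ler_pM.
  have x4 : 6 * z ^+ (a + K) <= z ^+ (14 * M + 31).
    by rewrite m5 pow_absorb // ler_nat.
  apply: le_trans (ler_normB _ _) _; apply: le_trans (lerD (ler_normB _ _) x3) _.
  by rewrite exprD in x4; move: x1 x2 x3 x4; clear; lra.
have VG : (2 * V + 1 < #|G|)%N.
  rewrite -(ltr_nat R) natrD natrM.
  have Vle : V%:R <= z ^+ (14 * M + 31) by rewrite truncn_le ltW.
  have : z ^+ (14 * M + 31 + 1) * z < #|G|%:R * z.
    have : z ^+ 3 * (z ^+ (14 * M + 31 + 1) * z) <= z ^+ 3 * #|G|%:R.
      apply: le_trans HG; apply: le_trans Hge.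
      by rewrite -m6 [leRHS]exprD expr1 [z ^+ (_ + 3)]exprD mulrA [z ^+ 3 * _]mulrC.
    rewrite ler_pM2l // => le; apply: (le_lt_trans le).
    rewrite ltr_pMr; first by apply: lt_le_trans z32; rewrite ltr1n.
    by apply: lt_le_trans le; rewrite mulr_gt0.
  rewrite ltr_pM2r // => lt; apply: lt_trans lt.
  rewrite addn1 exprS; have : 1 <= z ^+ (14 * M + 31) by exact: exprn_ege1.
  by move: z32 Vle; clear; nra.
have [i [j [iG jG ij mE]]] := pigeonhole_int mV VG.
have [ki wi li] := rel i iG; have [kj wj lj] := rel j jG.
have v0 : v = 0.
  apply/eqP; apply: contrapT => /negP vn0.
  set q := v * (j%:Z - i%:Z); set p := D * (l j - l i) - u * (k j - k i).
  have q0 : q != 0 by rewrite mulf_neq0 // subr_eq0; clear -ij; lia.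
  have qle : `|q|%:~R <= z ^+ (28 * M + 68).
    rewrite intr_norm /q intrM normrM -intr_norm m7 [leRHS]exprD expr1 exprD.
    have hij : `|(j%:Z - i%:Z)%:~R : R| <= Z.
      rewrite -intr_norm; apply: le_trans (HZ j).
      by rewrite -[j%:R]/((j%:Z)%:~R) ler_int; clear -ij; lia.
    apply: le_trans (ler_pM _ _ va hij) _ => //.
    rewrite -/Z -/a (exprD _ a K); set y := z ^+ a * z ^+ K * Z.
    have -> : 2 * z ^+ a * z ^+ K * Z = y * 2 by rewrite /y; ring.
    have y0 : 0 < y by rewrite /y !mulr_gt0 ?zX.
    by rewrite ler_pM2l //; apply: le_trans z32; rewrite ler_nat.
  have := dio2 _ q p q0 qle.
  (* The terms linear in b cancel because m i = m j. *)
  have -> : q%:~R * b ^+ 2 - p%:~R =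
      D%:~R * ((t * (k j)%:~R + (t * j%:R - (w j)%:~R) * b - (l j)%:~R) -
               (t * (k i)%:~R + (t * i%:R - (w i)%:~R) * b - (l i)%:~R)) -
      eps * (((k j)%:~R + b * j%:R) - ((k i)%:~R + b * i%:R)).
    have : (m i)%:~R = (m j)%:~R :> R by rewrite mE.
    rewrite /m /q /p !(intrB, intrD, intrM) /eps => E1.
    apply/eqP; rewrite -subr_eq0; apply/eqP.
    transitivity (b * ((v%:~R * (k i)%:~R + u%:~R * i%:R - D%:~R * (w i)%:~R) -
      (v%:~R * (k j)%:~R + u%:~R * j%:R - D%:~R * (w j)%:~R))); first by ring.
    by rewrite -[i%:R]/((i%:Z)%:~R) -[j%:R]/((j%:Z)%:~R) E1 subrr mulr0.
  set Y := `|_|; suff : Y <= z ^+ (a + K + (14 * M + 36).+1 + 3) / P%:R.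
    move=> hY; apply/negP; rewrite -ltNge.
    apply: le_lt_trans (ler_wpM2l (ltW (zX _)) hY) _.
    rewrite mulrA -exprD ltr_pdivrMr // mul1r; apply: lt_le_trans zA.
    apply: lt_le_trans (zle _ _ m8).
    by rewrite [ltRHS]exprD expr1 ltr_pMr //; apply: lt_le_trans z32; rewrite ltr1n.
  rewrite /Y; apply: le_trans (ler_normB _ _) _.
  rewrite [X in X + _]normrM -intr_norm [X in _ + X]normrM.
  have y1 : `|t * (k j)%:~R + (t * j%:R - (w j)%:~R) * b - (l j)%:~R -
      (t * (k i)%:~R + (t * i%:R - (w i)%:~R) * b - (l i)%:~R)| <= 2 * E.
    by apply: le_trans (ler_normB _ _) _; rewrite mulr_natl mulr2n lerD.
  have y2 : `|(k j)%:~R + b * j%:R - ((k i)%:~R + b * i%:R)| <= 4 * z * Z.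
    have bZ (p' : 'I_H) : `|b * p'%:R| <= (z - 1) * Z.
      by rewrite normrM normr_nat ler_pM //; move: bz; clear; lra.
    have -> : (k j)%:~R + b * j%:R - ((k i)%:~R + b * i%:R) =
       ((k j)%:~R - b * j%:R) - ((k i)%:~R - b * i%:R) + 2 * (b * j%:R) - 2 * (b * i%:R).
      by ring.
    apply: le_trans (ler_normB _ _) _; apply: le_trans (lerD (ler_normD _ _) (lexx _)) _.
    rewrite [`|2 * (b * j%:R)|]normrM [`|2 * (b * i%:R)|]normrM normr_nat.
    have := ler_normB ((k j)%:~R - b * j%:R) ((k i)%:~R - b * i%:R).
    have Z1 : 1 <= Z by exact: exprn_ege1.
    have := bZ i; have := bZ j; move: ki kj Z1; clear; lra.
  have Dn : 0 <= `|D|%:~R :> R by rewrite ler0z.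
  have y3 := ler_pM Dn (normr_ge0 _) Da y1.
  have y4 := ler_pM (normr_ge0 _) (normr_ge0 _) hD y2.
  apply: le_trans (lerD y3 y4) _.
  have -> : 2 * z ^+ a * (2 * E) + 2 * z ^+ a * E * (4 * z * Z) =
    z ^+ a * E * (4 + 8 * z * Z) by ring.
  have -> : z ^+ (a + K + (14 * M + 36).+1 + 3) / P%:R = z ^+ a * E * (z ^+ 3 * Z).
    by rewrite /E 3!exprD -/Z; ring.
  have aE : 0 <= z ^+ a * E by rewrite mulr_ge0 // ltW.
  apply: (ler_wpM2l aE).
  have Z1 : 1 <= Z by exact: exprn_ege1.
  have : 32 * 32 <= z * z by apply: ler_pM => //; lra.
  have -> : z ^+ 3 * Z = (z * z) * (z * Z) by ring.
  have : 0 < z * Z by rewrite mulr_gt0.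
  have : 1 <= z * Z by rewrite -[leLHS]mulr1 ler_pM.
  by clear; nra.
(* D may be negative: its sign is moved to the numerator. *)
have DE : D%:~R = (Num.sg D)%:~R * `|D|%N%:R :> R.
  by rewrite -[`|D|%N%:R]/((`|D|%N%:Z)%:~R) abszE -intrM -numEsg.
have sgn : (Num.sg D)%:~R * (Num.sg D)%:~R = 1 :> R.
  by rewrite -intrM -expr2 sqr_sg D0.
have D1 : 0 < `|D|%N%:R :> R by rewrite ltr0n absz_gt0.
exists `|D|%N, (Num.sg D * u); split; first by rewrite absz_gt0.
  apply: le_trans (_ : 2 * z ^+ a <= _); last by rewrite m9 pow_absorb // ler_nat.
  by rewrite -[`|D|%N%:R]/((`|D|%N%:Z)%:~R) abszE.
have -> : t - (Num.sg D * u)%:~R / `|D|%N%:R = (Num.sg D)%:~R * eps / `|D|%N%:R.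
  rewrite /eps v0 mulr0 subr0 DE intrM.
  transitivity ((Num.sg D)%:~R * (Num.sg D)%:~R * t - (Num.sg D)%:~R * u%:~R / `|D|%N%:R).
    by rewrite sgn mul1r.
  by field; rewrite gt_eqF.
have D1' : 1 <= `|D|%N%:R :> R by rewrite ler1n absz_gt0.
rewrite !normrM normfV normr_nat -intr_norm normr_sg D0 mul1r.
apply: le_trans (_ : `|eps| <= _).
  by rewrite ler_pdivrMr // ler_peMr.
apply: le_trans hD _; rewrite /E mulrA ler_pM2r ?invr_gt0 // -mulrA -exprD.
by rewrite m5 pow_absorb // ler_nat.
Qed.

(** Take a relation for a shift h = j D, with h within a power of z of P. Since xi h is tiny, D
    times the relation puts D w b near an integer, which forces w = 0 and then u k = D l exactly.
    Only |xi| |k + b h| <= z^K / P survives, and k + b h has size about 2 |b| h: this gains the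
    second factor P. *)
Lemma rational_approx_sharp (R : realType) (b z xi : R) (M P D c d K g : nat) (u : int) :
  K = (10 * M + 20)%N -> g = (c + d + (M * (c + K + 1) + c + 4))%N ->
  32 <= z -> `|b| + 1 <= z -> 1 <= z * `|b| -> dioph b z M ->
  (0 < D)%N -> D%:R <= z ^+ c -> `|xi| <= z ^+ d / P%:R ->
  z ^+ (g + K + 10) <= P%:R ->
  P%:R / z <= nrm (\sum_(n < P) bracket b (u%:~R / D%:R + xi) n) ->
  `|xi| <= z ^+ (K + g + 5) / P%:R ^+ 2.
Proof.
move=> KE gE; set s := (M * (c + K + 1) + c + 4)%N in gE.
have m1 : (4 <= g + K + 10)%N by clear; lia.
have m2 : (c <= g)%N by rewrite gE; clear; lia.
have m3 : (g + 9 <= g + K + 10)%N by clear; lia.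
have m4 : (K + s <= g + K + 10)%N by rewrite gE; clear; lia.
have m5 : (M * (c + K + 1) + 1 + c + 3 = s)%N by rewrite /s; clear; lia.
have m7 : g = (d + c + s)%N by rewrite gE; clear; lia.
have m8 : (c + 3 <= s)%N by rewrite /s; clear; lia.
have m9 : (K + g + 5 = (K + 1) + 3 + (g + 1))%N by clear; lia.
clearbody s; clear gE.
move=> z32 bz zb dio D0 Dz hxi zP big.
have z0 : 0 < z by apply: lt_le_trans z32.
have z1 : 1 <= z by apply: le_trans z32; rewrite ler1n.
have zX n : 0 < z ^+ n by exact: exprn_gt0.
have zle m n : (m <= n)%N -> z ^+ m <= z ^+ n by exact: ler_weXn2l.
have P0 : 0 < P%:R :> R by exact: lt_le_trans zP.
(* As g = d + c + s, any h = j D with j < H satisfies |xi| h z^s <= 1. *)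
pose H := Num.truncn (P%:R / z ^+ g).
have Hle : H%:R * z ^+ g <= P%:R.
  by rewrite -ler_pdivlMr // truncn_le divr_ge0 // ltW.
have z4P : z ^+ 9 <= P%:R / z ^+ g.
  rewrite ler_pdivlMr // -exprD addnC; apply: le_trans zP; exact: zle.
have Hge : P%:R <= H%:R * z ^+ (g + 1).
  have := truncnS_gt (P%:R / z ^+ g); rewrite -/H -natr1 => lt.
  have z9 : z * 1 <= z ^+ 9.
    by rewrite [leRHS]exprS ler_pM2l // exprn_ege1.
  have : P%:R / z ^+ g <= H%:R * z.
    by move: lt z4P z9 z32; clear; nra.
  by rewrite ler_pdivrMr // exprD expr1 -mulrA [z * _]mulrC.
have H8 : z ^+ 8 <= H%:R.
  have : z ^+ 9 * z ^+ g <= H%:R * z ^+ (g + 1).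
    by apply: le_trans Hge; rewrite -ler_pdivlMr.
  by rewrite exprS addn1 [z ^+ g.+1]exprS mulrA [z * z ^+ 8]mulrC ler_pM2r // ler_pM2r.
have HD : H%:R * D%:R <= P%:R :> R.
  apply: le_trans Hle; rewrite ler_wpM2l //; apply: le_trans Dz _; exact: zle.
have HDP : (H * D <= P)%N by rewrite -(ler_nat R) natrM.
have zH : 4 * z ^+ 2 <= H%:R.
  apply: le_trans H8; have -> : z ^+ 8 = z ^+ 6 * z ^+ 2 by ring.
  rewrite ler_pM2r // (@le_trans _ _ (z ^+ 1)) ?zle // expr1.
  by apply: le_trans z32; rewrite ler_nat.
have zP4 : z ^+ 4 <= P%:R by apply: le_trans zP; exact: zle.
have := many_relations z32 dio zP4 D0 HDP zH big; rewrite -KE.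
set G := [set j | _] => HG.
have G0 j : j \in G -> (0 < j)%N by rewrite inE => /andP[].
have G1 : (0 < #|G|)%N.
  rewrite -(ltr0n R) -(pmulr_rgt0 _ (zX 3%N)); apply: lt_le_trans HG.
  exact: lt_le_trans H8.
have [j jG Gj] := large_member G0 G1.
have j0 := G0 j jG.
have Hj : H%:R <= z ^+ 3 * j%:R.
  by apply: le_trans HG _; rewrite ler_pM2l // ler_nat.
move: jG; rewrite inE j0 => /asboolP [k [w [l [hk hw hl]]]].
set h := (j * D)%N in hk hw hl.
have jh : j%:R <= h%:R :> R by rewrite ler_nat /h leq_pmulr.
have j1 : 1 <= j%:R :> R by rewrite ler1n.
have h1 : 1 <= h%:R :> R by exact: le_trans jh.
have z5j : z ^+ 5 <= j%:R.
  rewrite -(ler_pM2l (zX 3%N)) -exprD; exact: le_trans Hj.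
have zh : z <= h%:R.
  by apply: le_trans jh; apply: le_trans z5j; rewrite -[leLHS]expr1 zle.
have hle : h%:R <= H%:R * z ^+ c.
  by rewrite natrM ler_pM // ler_nat ltnW.
have xih : `|xi| * h%:R * z ^+ s <= 1.
  have : `|xi| * h%:R <= z ^+ d / P%:R * (H%:R * z ^+ c) by exact: ler_pM.
  move=> /(ler_wpM2r (ltW (zX s))) le; apply: le_trans le _.
  have -> : z ^+ d / P%:R * (H%:R * z ^+ c) * z ^+ s = H%:R * z ^+ g / P%:R.
    by rewrite m7 2!exprD; ring.
  by rewrite ler_pdivrMr // mul1r.
have kh : `|k%:~R + b * h%:R| <= 2 * z * h%:R.
  have -> : k%:~R + b * h%:R = (k%:~R - b * h%:R) + 2 * (b * h%:R) by ring.
  apply: le_trans (ler_normD _ _) _; rewrite [`|2 * _|]normrM normrM !normr_nat.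
  have : `|b| * h%:R <= (z - 1) * h%:R.
    by rewrite ler_pM2r ?(lt_le_trans _ h1) //; move: bz; clear; lra.
  by move: hk h1; clear; lra.
set E := z ^+ K / P%:R in hl.
have EzS : E * z ^+ s <= 1.
  rewrite /E mulrAC -exprD ler_pdivrMr // mul1r; apply: le_trans zP; exact: zle.
have E0 : 0 < E by rewrite divr_gt0.
(* Multiplication by D clears the denominator of u / D; the right-hand side beats z^s by the choice
   of s. *)
have small : `|(D%:Z * w)%:~R * b - (u * k - D%:Z * l)%:~R| * z ^+ s <= z ^+ (c + 2).
  have DR : D%:R != 0 :> R by rewrite pnatr_eq0 -lt0n.
  have -> : (D%:Z * w)%:~R * b - (u * k - D%:Z * l)%:~R =
    D%:R * (xi * (k%:~R + b * h%:R) -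
      (u%:~R / D%:R * k%:~R + xi * k%:~R + (xi * h%:R - w%:~R) * b - l%:~R)).
    by rewrite intrB !intrM; field.
  rewrite normrM normr_nat -(mulrA D%:R) exprD.
  apply: ler_pM => //; first by rewrite mulr_ge0 // ltW.
  have t1 : `|xi * (k%:~R + b * h%:R)| * z ^+ s <= 2 * z.
    rewrite normrM; apply: (@le_trans _ _ (`|xi| * (2 * z * h%:R) * z ^+ s)).
      by rewrite ler_pM2r // ler_wpM2l.
    have -> : `|xi| * (2 * z * h%:R) * z ^+ s = 2 * z * (`|xi| * h%:R * z ^+ s) by ring.
    by rewrite ler_piMr // mulr_ge0 // ltW.
  have t2 := le_trans (ler_wpM2r (ltW (zX s)) hl) EzS.
  apply: le_trans (ler_wpM2r (ltW (zX s)) (ler_normB _ _)) _.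
  rewrite mulrDl; apply: le_trans (lerD t1 t2) _.
  by rewrite expr2; move: z32; clear; nra.
have w0 : w = 0.
  apply/eqP; apply: contrapT => /negP wn0.
  have q0 : D%:Z * w != 0 by rewrite mulf_neq0 // -lt0n.
  have qle : `|D%:Z * w|%:~R <= z ^+ (c + K + 1).
    rewrite intr_norm intrM normrM normr_nat -addnA exprD ler_pM //.
    have : `|w%:~R : R| <= `|w%:~R - xi * h%:R| + `|xi * h%:R|.
      by rewrite -{1}(subrK (xi * h%:R) w%:~R) ler_normD.
    have : `|xi * h%:R| <= 1.
      rewrite normrM normr_nat; apply: le_trans xih.
      by rewrite ler_peMr ?mulr_ge0 // exprn_ege1.
    rewrite exprD expr1; have : 1 <= z ^+ K by exact: exprn_ege1.
    by move: z32 hw; clear; nra.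
  have := dio _ _ (u * k - D%:Z * l) q0 qle.
  apply/negP; rewrite -ltNge -(ltr_pM2r (zX s)) -mulrA mul1r.
  apply: le_lt_trans (ler_wpM2l (ltW (zX _)) small) _.
  rewrite -exprD; apply: (@lt_le_trans _ _ (z ^+ (M * (c + K + 1) + 1 + (c + 2) + 1))).
    by rewrite [ltRHS]exprD expr1 ltr_pMr //; apply: lt_le_trans z32; rewrite ltr1n.
  by rewrite zle // -m5 -!addnA.
(* With w = 0 the small quantity is itself an integer. *)
have uk : u * k - D%:Z * l = 0.
  apply/eqP; apply: contrapT => /negP ne; move: small.
  rewrite w0 mulr0 mul0r sub0r normrN -intr_norm.
  have : 1 <= `|u * k - D%:Z * l|%:~R :> R by rewrite ler1z -gtz0_ge1 normr_gt0.
  set y := _%:~R => y1; apply/negP; rewrite -ltNge.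
  apply: (@lt_le_trans _ _ (z ^+ s)); last by rewrite ler_peMl // ltW.
  apply: (@lt_le_trans _ _ (z ^+ (c + 2) * z)).
    by rewrite ltr_pMr //; apply: lt_le_trans z32; rewrite ltr1n.
  by rewrite -exprSr; apply: zle; rewrite addn2 -addn3.
have DR : D%:R != 0 :> R by rewrite pnatr_eq0 -lt0n.
have rl : u%:~R / D%:R * k%:~R = l%:~R :> R.
  have : (u * k)%:~R = (D%:Z * l)%:~R :> R.
    by congr (_%:~R); apply/eqP; rewrite -subr_eq0 uk.
  rewrite !intrM => E1; apply: (mulfI DR).
  by rewrite -[RHS]E1; field.
have {hl} : `|xi| * `|k%:~R + b * h%:R| <= E.
  rewrite -normrM; move: hl; rewrite rl w0.
  by have -> : l%:~R + xi * k%:~R + (xi * h%:R - 0%:~R) * b - l%:~R =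
    xi * (k%:~R + b * h%:R) by ring.
(* k is within 1 of b h, so k + b h is within 1 of 2 b h, and z |b| >= 1. *)
have bh : h%:R <= z * `|k%:~R + b * h%:R|.
  have b0 : 0 < `|b| by rewrite -(pmulr_rgt0 _ z0) (lt_le_trans _ zb).
  have x1 : 2 * `|b * h%:R| <= `|k%:~R + b * h%:R| + 1.
    rewrite -[2]ger0_norm // -normrM.
    have -> : 2 * (b * h%:R) = (k%:~R + b * h%:R) - (k%:~R - b * h%:R) by ring.
    by apply: le_trans (ler_normB _ _) _; rewrite lerD2l.
  have x2 : h%:R <= z * `|b * h%:R|.
    by rewrite normrM normr_nat mulrA ler_peMl.
  by move: x1 x2 zh z0; clear; set y := `|_|; set y' := `|_|; nra.
move=> hE; have xh : `|xi| * h%:R <= z * E.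
  apply: le_trans (ler_wpM2l (normr_ge0 xi) bh) _.
  by rewrite mulrCA ler_pM2l.
have hP : P%:R <= h%:R * (z ^+ 3 * z ^+ (g + 1)).
  apply: le_trans Hge _; rewrite mulrCA mulrA ler_pM2r //.
  by apply: le_trans Hj _; rewrite ler_pM2l.
rewrite ler_pdivlMr ?exprn_gt0 // expr2 mulrA.
have -> : z ^+ (K + g + 5) = z * E * (z ^+ 3 * z ^+ (g + 1)) * P%:R.
  by rewrite m9 3!exprD expr1 /E; field; rewrite gt_eqF.
rewrite ler_pM2r //; apply: le_trans (ler_wpM2l (normr_ge0 xi) hP) _.
by rewrite (mulrA `|xi|) ler_pM2r // mulr_gt0.
Qed.

(** * Positivity of quadratic cosine sums *)

(* The antiderivative of [cos (a t ^ 2)] up to a nonpositive term, obtained by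
   integrating by parts twice. *)
Definition fresnel_tail (R : realType) (a t : R) : R :=
  sin (a * t ^+ 2) / (2 * a * t) +
  (1 - cos (a * t ^+ 2)) / (4 * a ^+ 2 * t ^+ 3).

(** The derivative of the tail is cos(a t^2) minus the nonnegative term 3 (1 - cos(a t^2)) / (4 a^2
    t^4); apply the mean value theorem. *)
Lemma fresnel_tail_incr (R : realType) (a x y m : R) : 0 < a -> 0 < x <= y ->
  (forall t, x <= t <= y -> cos (a * t ^+ 2) <= m) ->
  fresnel_tail a y - fresnel_tail a x <= (y - x) * m.
Proof.
move=> a0 /andP[x0 xy] hm; pose F := fresnel_tail a.
pose dF t := cos (a * t ^+ 2) - 3 * (1 - cos (a * t ^+ 2)) / (4 * a ^+ 2 * t ^+ 4).
have dFE (t : R) : x <= t <= y -> is_derive t 1 F (dF t).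
  move=> /andP[xt _]; have t0 : 0 < t by exact: lt_le_trans xt.
  have tn0 : t != 0 by rewrite gt_eqF.
  have d1 : is_derive t 1 (fun t : R => a * t ^+ 2) (a * (2 * t)).
    apply: is_derive_eq; rewrite /GRing.scale /=; ring.
  have d2 : is_derive t 1 (fun t : R => sin (a * t ^+ 2)) (cos (a * t ^+ 2) * (a * (2 * t))).
    exact: (@is_derive1_comp _ sin (fun t : R => a * t ^+ 2)).
  have d3 : is_derive t 1 (fun t : R => cos (a * t ^+ 2)) (- sin (a * t ^+ 2) * (a * (2 * t))).
    exact: (@is_derive1_comp _ cos (fun t : R => a * t ^+ 2)).
  have d4 : is_derive t 1 (fun t : R => (2 * a * t)^-1) (- (2 * a * t) ^- 2 *: (2 * a)).
    apply: is_deriveV; first by rewrite !mulf_neq0 // gt_eqF.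
    by apply: is_derive_eq; rewrite /GRing.scale /=; ring.
  have d5 : is_derive t 1 (fun t : R => (4 * a ^+ 2 * t ^+ 3)^-1)
      (- (4 * a ^+ 2 * t ^+ 3) ^- 2 *: (4 * a ^+ 2 * (3 * t ^+ 2))).
    apply: is_deriveV; first by rewrite !mulf_neq0 ?expf_neq0 // gt_eqF.
    by apply: is_derive_eq; rewrite /GRing.scale /=; ring.
  have d6 : is_derive t 1 (fun t : R => 1 - cos (a * t ^+ 2)) (sin (a * t ^+ 2) * (a * (2 * t))).
    by apply: is_derive_eq; ring.
  have d7 := is_deriveD (is_deriveM d2 d4) (is_deriveM d6 d5).
  apply: (is_derive_eq d7); rewrite /GRing.scale /dF /=.
  by field; rewrite !gt_eqF.
have [t [xt ty ->]] := MVT_R xy dFE.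
rewrite mulrC ler_wpM2l ?subr_ge0 //.
have t0 : 0 < t by exact: lt_le_trans xt.
apply: le_trans (hm t _); last by rewrite xt.
by rewrite /dF gerBl divr_ge0 ?mulr_ge0 ?exprn_ge0 ?(ltW a0) ?(ltW t0) // subr_ge0 cos_le1.
Qed.

(** Near 0, where the tail is singular, the Taylor bound cos v >= 1 - v^2 / 2 with v = a t^2 is
    integrated instead. *)
Lemma fresnel_head_incr (R : realType) (a x y m : R) : x <= y ->
  (forall t, x <= t <= y -> cos (a * t ^+ 2) <= m) ->
  (y - a ^+ 2 * y ^+ 5 / 10) - (x - a ^+ 2 * x ^+ 5 / 10) <= (y - x) * m.
Proof.
move=> xy hm; pose F (t : R) := t - a ^+ 2 * t ^+ 5 / 10.
have dFE (t : R) : x <= t <= y -> is_derive t 1 F (1 - (a * t ^+ 2) ^+ 2 / 2).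
  by move=> _; apply: is_derive_eq; rewrite /GRing.scale /=; field.
have [t [xt ty ->]] := MVT_R xy dFE.
rewrite mulrC ler_wpM2l ?subr_ge0 //.
by apply: le_trans (cos_ge_quad _) (hm t _); rewrite xt.
Qed.

(** The sum is compared with a lower estimate F for the integral of cos(a t^2) from 0. The
    comparison costs a J^2 in total, and F is nonnegative at J. *)
Lemma sum_cos_sqr_ge (R : realType) (a : R) (J : nat) : 0 <= a ->
  - (a * J%:R ^+ 2) <= \sum_(j < J) cos (a * j%:R ^+ 2).
Proof.
rewrite le_eqVlt => /orP[/eqP<-|a0].
  rewrite mul0r oppr0 sumr_ge0 // => j _; rewrite mul0r cos0; exact: ler01.
pose s := (Num.sqrt a)^-1; have s0 : 0 < s by rewrite invr_gt0 sqrtr_gt0.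
have as2 : a * s ^+ 2 = 1 by rewrite /s exprVn sqr_sqrtr ?divff ?gt_eqF // ltW.
pose Q (t : R) := t - a ^+ 2 * t ^+ 5 / 10.
(* Head and tail estimates glued continuously at s = a^(-1/2), where a s^2 = 1. *)
pose F (t : R) := if t <= s then Q t else Q s - fresnel_tail a s + fresnel_tail a t.
have Fincr x y m : 0 <= x <= y ->
    (forall t, x <= t <= y -> cos (a * t ^+ 2) <= m) -> F y - F x <= (y - x) * m.
  move=> /andP[x0 xy] hm; rewrite /F.
  have [ys|ys] := leP y s.
    by rewrite (le_trans xy ys); exact: fresnel_head_incr.
  have [xs|xs] := leP x s; last first.
    have xp : 0 < x <= y by rewrite (lt_trans s0 xs).
    by have := fresnel_tail_incr a0 xp hm; clear; lra.
  have h1 : Q s - Q x <= (s - x) * m.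
    by apply: fresnel_head_incr => // t /andP[xt ts]; rewrite hm // xt (le_trans ts) // ltW.
  have h2 : fresnel_tail a y - fresnel_tail a s <= (y - s) * m.
    apply: fresnel_tail_incr => //; first by rewrite s0 ltW.
    by move=> t /andP[st ty]; rewrite hm // ty (le_trans xs).
  by move: h1 h2; clear; lra.
(* On [j, j + 1] the angle exceeds a j^2 by at most a (2 j + 1), and cosine is 1-Lipschitz; these
   errors add up to a J^2. *)
have step (j : nat) : F j.+1%:R - F j%:R <= cos (a * j%:R ^+ 2) + a * (2 * j%:R + 1).
  have -> : cos (a * j%:R ^+ 2) + a * (2 * j%:R + 1) =
      (j.+1%:R - j%:R) * (cos (a * j%:R ^+ 2) + a * (2 * j%:R + 1)).
    by rewrite -(natr1 j) addrAC subrr add0r mul1r.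
  apply: Fincr => [|t /andP[jt tj]]; first by rewrite ler0n ler_nat leqnSn.
  rewrite -lerBlDl; apply: le_trans (ler_norm _) _; apply: le_trans (cos_lip _ _) _.
  rewrite -mulrBr normrM (gtr0_norm a0) ler_pM2l //.
  move: tj; rewrite -(natr1 j) => tj; have j0 := ler0n R j.
  by rewrite ger0_norm; move: tj jt j0; clear; nra.
have sum : F J%:R - F 0 <= \sum_(j < J) (cos (a * j%:R ^+ 2) + a * (2 * j%:R + 1)).
  elim: J => [|J IH]; first by rewrite big_ord0 subrr.
  by rewrite big_ord_recr /=; have := step J; move: IH; clear; lra.
have -> : - (a * J%:R ^+ 2) = - \sum_(j < J) a * (2 * j%:R + 1).
  congr (- _); elim: (J) => [|n IH]; first by rewrite big_ord0 expr0n /= mulr0.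
  by rewrite big_ord_recr /= -IH -(natr1 n); ring.
rewrite big_split /= in sum; rewrite -subr_ge0 opprK.
apply: le_trans sum; have -> : F 0 = 0.
  by rewrite /F (ltW s0) /Q expr0n /= mulr0 mul0r subrr.
rewrite subr0.
rewrite /F /Q; set t : R := J%:R; have t0 : 0 <= t by rewrite ler0n.
have [ts|st] := leP t s.
  have at1 : a * t ^+ 2 <= 1.
    by rewrite -as2 ler_pM2l // ler_sqr ?nnegrE // ltW.
  have -> : t - a ^+ 2 * t ^+ 5 / 10 = t * (1 - (a * t ^+ 2) ^+ 2 / 10) by field.
  rewrite mulr_ge0 // subr_ge0.
  have : 0 <= a * t ^+ 2 by rewrite mulr_ge0 ?sqr_ge0 // ltW.
  by move: at1; clear; nra.
have tp : 0 < t by exact: lt_trans st.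
have aE : a = (s ^+ 2)^-1 by apply: (mulIf (x := s ^+ 2)); rewrite ?as2 ?mulVf ?expf_neq0 ?gt_eqF.
have -> : s - a ^+ 2 * s ^+ 5 / 10 - fresnel_tail a s =
    s * (9 / 10 - sin 1 / 2 - (1 - cos 1) / 4).
  by rewrite /fresnel_tail as2 aE; field; rewrite gt_eqF.
(* Doubling the bound cos(1/2) >= 7/8 gives cos 1 >= 17/32, and sin 1 <= 0.848 follows. *)
have c1 : 17 / 32 <= cos (1 : R).
  have h := cos_ge_quad (1 / 2 : R).
  have -> : cos (1 : R) = cos (1 / 2) ^+ 2 *+ 2 - 1.
    by rewrite -cos_mulr2n; congr cos; rewrite -mulr_natr; field.
  by rewrite mulr2n; move: h; clear; nra.
have s1 : sin (1 : R) <= 848 / 1000.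
  have := cos2Dsin2 (1 : R); have : 0 <= sin (1 : R).
    by have := @sin_ge_half R 1; rewrite ler01 lexx => /(_ isT); lra.
  by move: c1; clear; nra.
set r := 9 / 10 - _ - _; have r1 : 355 / 1000 <= r by rewrite /r; move: c1 s1; clear; lra.
rewrite /fresnel_tail; set y := a * t ^+ 2.
have -> : sin y / (2 * a * t) = s * (s / t * sin y / 2).
  by rewrite aE; field; rewrite !gt_eqF.
have q0 : 0 <= (1 - cos y) / (4 * a ^+ 2 * t ^+ 3).
  apply: divr_ge0; first by rewrite subr_ge0 cos_le1.
  by rewrite !mulr_ge0 ?exprn_ge0 ?(ltW a0).
rewrite addrA addr_ge0 // -mulrDr mulr_ge0 ?(ltW s0) //.
have st0 : 0 < s / t by rewrite divr_gt0.
(* For y <= 2 <= pi the sine is nonnegative. Otherwise s / t = y^(-1/2) is below 0.708, so the sine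
   term is at least -0.354, which r >= 0.355 outweighs. *)
have [y2|y2] := leP y 2.
  apply: addr_ge0; first by move: r1; clear; lra.
  rewrite divr_ge0 // mulr_ge0 ?(ltW st0) // sin_ge0_pi //.
  by rewrite (le_trans y2) ?pi_ge2 // mulr_ge0 ?sqr_ge0 // ltW.
have stlt : (s / t) ^+ 2 < 1 / 2.
  have -> : (s / t) ^+ 2 = y^-1 by rewrite /y aE; field; rewrite !gt_eqF.
  by rewrite -[1 / 2]invrK ltf_pV2 ?posrE ?invr_gt0 ?divr_gt0 //; lra.
have := sin_geN1 y; set w := s / t in st0 stlt *; set v := sin y => v1.
have : w <= 708 / 1000 by move: st0 stlt; clear; nra.
by move: st0 r1 v1; clear; nra.
Qed.

(** * Frequencies close to a rational *)

Lemma sum_mod_split (V : nmodType) (F : nat -> V) (D J : nat) :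
  \sum_(n < D * J) F n = \sum_(a < D) \sum_(j < J) F (a + j * D)%N.
Proof.
elim: J => [|J IH].
  rewrite muln0 big_ord0 big1 // => a _; exact: big_ord0.
under [RHS]eq_bigr => a _ do rewrite big_ord_recr /=.
rewrite big_split /= -IH mulnS addnC big_split_ord /=; congr (_ + _).
by apply: eq_bigr => a _; rewrite addnC mulnC.
Qed.

Lemma sum_e_frac_ndvd (R : realType) (D : nat) (c : int) : ~~ (D %| c)%Z ->
  \sum_(j < D) e (c%:~R / D%:R * j%:R : R) = 0.
Proof.
case: D => [|D] nd; first by rewrite big_ord0.
have nz : (c %% D.+1)%Z != 0 by apply: contra nd => /eqP h; apply/dvdz_mod0P.
have cD : (0 < `|(c %% D.+1)%Z| < D.+1)%N.
  have := @modz_ge0 c D.+1 isT; have := @ltz_pmod c D.+1 isT.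
  by move: nz; clear; lia.
apply: etrans (sum_e_frac R cD); apply: eq_bigr => j _; rewrite {1}(divz_eq c D.+1).
rewrite -[RHS](eDint _ ((c %/ D.+1)%Z * j%:Z)); congr e.
rewrite intrD !intrM -[(D.+1%:Z)%:~R]/(D.+1%:R); have : D.+1%:R != 0 :> R by rewrite pnatr_eq0.
by move: (D.+1%:R : R) => d d0; field.
Qed.

(** Writing r = a + j N with a < N gives floor(D r / (N D)) = j, so each a contributes a full sum of
    powers of a nontrivial D-th root of unity. This is the vanishing of the mean of the step
    function in [class_cancel]. *)
Lemma sum_step_phase (R : realType) (D N : nat) (c : int) : (0 < N)%N ->
  ~~ (D %| c)%Z ->
  \sum_(r < N * D) e (- (c%:~R / D%:R) *
     (Num.floor (D%:R * (r%:R / (N * D)%:R) : R))%:~R : R) = 0.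
Proof.
move=> N0 nd; have [->|D0] := posnP D; first by rewrite muln0 big_ord0.
have NR : 0 < N%:R :> R by rewrite ltr0n.
have DR : 0 < D%:R :> R by rewrite ltr0n.
rewrite (sum_mod_split (fun r : nat => e (- (c%:~R / D%:R) *
  (Num.floor (D%:R * (r%:R / (N * D)%:R) : R))%:~R : R))) big1 // => a _.
have nd' : ~~ (D %| - c)%Z by move: nd; rewrite !dvdzE abszN.
apply: etrans (sum_e_frac_ndvd R nd'); apply: eq_bigr => j _; congr e.
rewrite intrN !mulNr; congr (- (_ * _)).
have -> : D%:R * ((a + j * N)%:R / (N * D)%:R) = a%:R / N%:R + (j%:Z)%:~R :> R.
  by rewrite natrD !natrM; field; rewrite !gt_eqF.
rewrite floorDrz ?intr_int // intrKfloor intrD.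
rewrite (_ : Num.floor _ = 0) ?add0r //; apply: floor_def.
by rewrite divr_ge0 //= add0r ltr_pdivrMr // mul1r ltr_nat.
Qed.

(** * Sums over a residue class modulo [D] *)

Definition quad_phase (R : realType) (y : R) (n : nat) : R[i] := e (- y * n%:R ^+ 2).

(** As n is congruent to a, u n / D may be replaced by u a / D against an integer. In the [xi] part
    the floor is replaced by b n, with an error of at most 1 in the floor. *)
Lemma bracket_quad (R : realType) (b xi : R) (D a j n : nat) (u : int) : (0 < D)%N ->
  n = (a + j * D)%N ->
  nrm (bracket b (u%:~R / D%:R + xi) n - quad_phase (xi * b) n *
    e (- ((u * a%:Z)%:~R / D%:R) * (Num.floor (b * n%:R))%:~R)) <=
  16 * `|xi| * n%:R.
Proof.
move=> D0 nE; have DR : D%:R != 0 :> R by rewrite pnatr_eq0 -lt0n.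
set F := Num.floor (b * n%:R).
have -> : bracket b (u%:~R / D%:R + xi) n =
    e (- xi * n%:R * F%:~R) * e (- ((u * a%:Z)%:~R / D%:R) * F%:~R).
  rewrite /bracket -/F -eD -[RHS](eDint _ (- u * j%:Z * F)); congr e.
  by rewrite !intrM intrN nE natrD natrM; field.
rewrite -mulrBl Normc.normcM nrm_e mulr1; apply: le_trans (e_lip _ _) _.
rewrite -(mulrA 16) ler_pM2l //.
have -> : - xi * n%:R * F%:~R - - (xi * b) * n%:R ^+ 2 =
  (xi * n%:R) * (b * n%:R - F%:~R) by ring.
have := floor_itv (b * n%:R); rewrite -/F intrD => /andP[f1 f2].
rewrite normrM normrM normr_nat -[leRHS]mulr1 ler_wpM2l ?mulr_ge0 //.
by rewrite ler_norml; apply/andP; split; move: f1 f2; clear; lra.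
Qed.

(** Partial summation: the squares of a + j D increase with j, so the total variation of the
    quadratic phase telescopes. *)
Lemma quad_phase_sum_le (R : realType) (y x C : R) (D a J : nat) : 0 <= C ->
  (forall n, nrm (\sum_(j < n) e (x * j%:R)) <= C) ->
  nrm (\sum_(j < J) quad_phase y (a + j * D) * e (x * j%:R)) <=
    C * (1 + 16 * `|y| * (a + J * D)%:R ^+ 2).
Proof.
move=> C0 hC.
apply: le_trans (@abel_le R J (fun j => quad_phase y (a + j * D))
  (fun j => e (x * j%:R)) C hC) _.
rewrite ler_wpM2l // nrm_e lerD2l.
pose g j := 16 * `|y| * (a + j * D)%:R ^+ 2.
have step j : nrm (quad_phase y (a + j.+1 * D) - quad_phase y (a + j * D)) <=
    g j.+1 - g j.
  apply: le_trans (e_lip _ _) _; rewrite -mulrBr normrM normrN.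
  rewrite /g -mulrBr mulrA ler_wpM2l ?mulr_ge0 // ger0_norm // subr_ge0.
  by rewrite ler_sqr ?nnegrE // ler_nat leq_add2l leq_mul2r leqnSn orbT.
apply: (@le_trans _ _ (g J - g 0%N)); last first.
  by rewrite /g gerBl mulr_ge0 ?sqr_ge0 // mulr_ge0.
elim: (J) => [|n IH]; first by rewrite big_ord0 subrr.
rewrite big_ord_recr; have -> : g n.+1 - g 0%N = (g n - g 0%N) + (g n.+1 - g n) by ring.
exact: lerD IH (step n).
Qed.

(** The factor carrying the floor is a step function of b n / D of period 1 and mean zero. Its Fejer
    expansion has no constant term, and at nonzero frequencies the geometric sums are bounded by the
    Diophantine condition, the slow quadratic phase being removed by partial summation. *)
Lemma class_cancel (R : realType) (b z xi : R) (M P D J a c f i0 kp iN : nat) (u : int) :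
  i0 = (2 * c + 7)%N -> kp = (M * i0 + c + 2)%N -> iN = (2 * c + 2 * kp + 7)%N ->
  32 <= z -> `|b| + 1 <= z -> dioph b z M -> (0 < D)%N -> D%:R <= z ^+ c ->
  `|xi| <= z ^+ f / P%:R ^+ 2 -> (a < D)%N -> (J * D <= P)%N ->
  ~~ (D %| u * a%:Z)%Z ->
  z ^+ (iN + (M * iN + f + 5) + (c + 6)) <= P%:R ->
  nrm (\sum_(j < J) bracket b (u%:~R / D%:R + xi) (a + j * D)) <= P%:R / z ^+ (c + 4).
Proof.
move=> i0E kpE iNE.
have m1 : (c + 6 <= iN + (M * iN + f + 5) + (c + 6))%N by clear; lia.
have m3 : (f.+1 + (c + 6) <= iN + (M * iN + f + 5) + (c + 6))%N by clear; lia.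
have m4 : (M * i0 + 1 + c + 1 = kp)%N by rewrite kpE; clear; lia.
have m5 : (c + (2 * kp + c + 7) = iN)%N by rewrite iNE; clear; lia.
have m6 : (c + 6 + kp * 2 = 2 * kp + c + 6)%N by clear; lia.
have m7 : (2 * kp + c + 7 = (2 * kp + c + 6).+1)%N by clear; lia.
have m8 : (c + (c + 7) = i0)%N by rewrite i0E; clear; lia.
have m9 : (c + 7 = (c + 6).+1)%N by clear; lia.
have m10 : (M * iN + f + 5 = (M * iN + 1) + (f + 4))%N by clear; lia.
have m11 : (c <= iN + (M * iN + f + 5) + (c + 6))%N by clear; lia.
have m12 (N : nat) (i i' : 'I_N) : i != i' -> i%:Z - i'%:Z != 0 /\ `|i%:Z - i'%:Z| <= N%:Z.
  by rewrite -val_eqE /=; have := ltn_ord i; have := ltn_ord i'; lia.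
have m13 (n n' : nat) : (0 < n)%N -> (0 < n')%N -> (n * n')%N%:Z != 0 by lia.
move=> z32 bz dio D0 Dz hxi aD JDP nd zP.
have z0 : 0 < z by apply: lt_le_trans z32.
have z1 : 1 <= z by apply: le_trans z32; rewrite ler1n.
have zX n : 0 < z ^+ n by exact: exprn_gt0.
have zle m n : (m <= n)%N -> z ^+ m <= z ^+ n by exact: ler_weXn2l.
have P0 : 0 < P%:R :> R by exact: lt_le_trans zP.
have DR : 0 < D%:R :> R by rewrite ltr0n.
have JP : J%:R <= P%:R :> R.
  by rewrite ler_nat (leq_trans _ JDP) // leq_pmulr.
have nP j : (j < J)%N -> (a + j * D)%:R <= P%:R :> R.
  move=> jJ; rewrite ler_nat (leq_trans _ JDP) //.
  by apply: leq_trans (leq_mul jJ (leqnn D)); rewrite mulSn leq_add2r ltnW.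
have xiP : `|xi| * P%:R ^+ 2 <= z ^+ f by rewrite -ler_pdivlMr ?exprn_gt0.
pose F (j : nat) : R[i] := e (- ((u * a%:Z)%:~R / D%:R : R) * (Num.floor (b * (a + j * D)%:R))%:~R).
have err : nrm (\sum_(j < J) bracket b (u%:~R / D%:R + xi) (a + j * D)) <=
    nrm (\sum_(j < J) quad_phase (xi * b) (a + j * D) * F j) + 16 * z ^+ f.
  rewrite -lerBlDl; apply: (@le_trans _ _ (nrm (\sum_(j < J)
    (bracket b (u%:~R / D%:R + xi) (a + j * D) - quad_phase (xi * b) (a + j * D) * F j)))).
    rewrite sumrB lerBlDr; apply: le_trans (le_nrmD _ _).
    by rewrite subrK.
  apply: le_trans (le_nrm_sum _ _ _) _.
  apply: (@le_trans _ _ (\sum_(j < J) 16 * `|xi| * P%:R)).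
    apply: ler_sum => j _; apply: le_trans (bracket_quad b xi u D0 erefl) _.
    by rewrite ler_wpM2l ?mulr_ge0 // nP.
  rewrite sumr_const card_ord -(mulr_natr _ J) -!(mulrA 16) ler_pM2l //.
  apply: le_trans xiP; rewrite -mulrA ler_wpM2l // expr2.
  by rewrite ler_wpM2l.
pose k' := (z ^+ kp)^-1; have k0 : 0 < k' by rewrite invr_gt0.
have /andP[Qge Qle] := truncn_pow (c + 6) z32; set Q := Num.truncn _ in Qge Qle.
have Q0 : (0 < Q)%N by rewrite -(ltr0n R); exact: lt_le_trans Qge.
have /andP[N'ge N'le] := truncn_pow (2 * kp + c + 6) z32.
set N' := Num.truncn _ in N'ge N'le.
have N'0 : (0 < N')%N by rewrite -(ltr0n R); exact: lt_le_trans N'ge.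
(* The grid size is a multiple of D, so that the grid mean of the step function vanishes exactly. *)
pose N := (N' * D)%N; have N0 : (0 < N)%N by rewrite muln_gt0 N'0.
have Nge : z ^+ (2 * kp + c + 6) <= N%:R.
  by apply: le_trans N'ge _; rewrite ler_nat leq_pmulr.
have Nle : N%:R <= z ^+ iN.
  by rewrite natrM -m5 addnC exprD m7 ler_pM.
have gap (d : nat) : (0 < d < Q)%N ->
    forall l : int, 2 * (D%:R * k') < `|d%:R * (b * D%:R) - l%:~R|.
  move=> /andP[d0 dQ] l.
  have qle : `|(D * d)%N%:Z|%:~R <= z ^+ i0.
    have -> : `|(D * d)%N%:Z|%:~R = D%:R * d%:R :> R by rewrite -natrM.
    rewrite -m8 exprD m9 ler_pM //.
    by apply: le_trans Qle; rewrite ler_nat ltnW.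
  have := dio i0 _ l (m13 _ _ D0 d0) qle.
  have -> : (D * d)%N%:Z%:~R * b - l%:~R = d%:R * (b * D%:R) - l%:~R.
    have -> : (D * d)%N%:Z%:~R = D%:R * d%:R :> R by rewrite -natrM.
    ring.
  set y := `|_| => hy.
  rewrite -(ltr_pM2l (zX (M * i0 + 1)%N)); apply: lt_le_trans hy.
  have -> : z ^+ (M * i0 + 1) * (2 * (D%:R * k')) = 2 * (D%:R / (z ^+ c * z)).
    rewrite /k' -m4 [z ^+ (_ + 1 + c + 1)]exprD [z ^+ (_ + 1 + c)]exprD expr1.
    by field; rewrite !gt_eqF.
  rewrite mulrA ltr_pdivrMr ?mulr_gt0 // mul1r.
  apply: (@le_lt_trans _ _ (2 * z ^+ c)); first by rewrite ler_pM2l.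
  by rewrite mulrC ltr_pM2l //; apply: lt_le_trans z32; rewrite ltr_nat.
pose bad (x : R) : bool := `[< exists l : int, `|D%:R * x - l%:~R| <= D%:R * k' >].
pose G (x : R) : R[i] := e (- ((u * a%:Z)%:~R / D%:R) * (Num.floor (D%:R * x))%:~R).
pose x j : R := b * (a + j * D)%:R / D%:R.
have xE j : D%:R * x j = b * D%:R * j%:R + b * a%:R.
  by rewrite /x natrD natrM; field; rewrite gt_eqF.
pose B := z ^+ (M * iN + f + 5).
have four (i i' : 'I_N) : i != i' ->
    nrm (\sum_(j < J) quad_phase (xi * b) (a + j * D) * e (x j * (i%:Z - i'%:Z)%:~R)) <= B.
  move=> /m12[]; set m := i%:Z - i'%:Z => mn0 mN.
  have hC n : nrm (\sum_(j < n) e (m%:~R * b * j%:R)) <= 2 * z ^+ (M * iN + 1).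
    have [l hl] := geom_e (m%:~R * b) n.
    have mz : `|m|%:~R <= z ^+ iN.
      by apply: le_trans Nle; rewrite -[N%:R]/((N%:Z)%:~R) ler_int.
    have := dio iN m l mn0 mz; move: hl.
    set y := nrm _; set t := `|_|; set Z := z ^+ _ => hl tZ.
    have y0 : 0 <= y by exact: nrm_ge0.
    have := ler_wpM2r y0 tZ; rewrite mul1r -mulrA => le.
    apply: le_trans le _; rewrite [leRHS]mulrC ler_wpM2l //.
    by rewrite /Z ltW.
  have C0 : 0 <= 2 * z ^+ (M * iN + 1) by rewrite mulr_ge0 // ltW.
  have := quad_phase_sum_le (xi * b) D a J C0 hC.
  have -> : \sum_(j < J) quad_phase (xi * b) (a + j * D) * e (x j * m%:~R) =
      e (m%:~R * b * a%:R / D%:R) *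
      \sum_(j < J) quad_phase (xi * b) (a + j * D) * e (m%:~R * b * j%:R).
    rewrite mulr_sumr; apply: eq_bigr => j _; rewrite mulrCA; congr (_ * _).
    by rewrite -eD; congr e; rewrite /x natrD natrM; field; rewrite gt_eqF.
  rewrite Normc.normcM nrm_e mul1r => le; apply: le_trans le _.
  rewrite /B m10 [leRHS]exprD [2 * _]mulrC -(mulrA (z ^+ (M * iN + 1))) ler_pM2l //.
  have aJD : (a + J * D)%:R <= 2 * P%:R :> R.
    rewrite natrD mulr_natl mulr2n lerD //.
      apply: (@le_trans _ _ (z ^+ c)); first by apply: le_trans Dz; rewrite ler_nat ltnW.
      by apply: le_trans zP; apply: zle.
    by rewrite ler_nat.
  have q1 : `|xi * b| * (a + J * D)%:R ^+ 2 <= 4 * (z * z ^+ f).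
    apply: (@le_trans _ _ (`|xi * b| * (2 * P%:R) ^+ 2)).
      by rewrite ler_wpM2l // ler_sqr ?nnegrE // mulr_ge0 // ltW.
    have -> : `|xi * b| * (2 * P%:R) ^+ 2 = 4 * (`|b| * (`|xi| * P%:R ^+ 2)).
      by rewrite normrM; ring.
    rewrite ler_pM2l //; apply: ler_pM; [by []|by rewrite mulr_ge0 ?sqr_ge0| |exact: xiP].
    by move: bz; clear; lra.
  have zf1 : 1 <= z * z ^+ f by rewrite -exprS exprn_ege1.
  have -> : z ^+ (f + 4) = (z * z ^+ f) * (z * z * z) by rewrite exprD; ring.
  have z2 : 1024 <= z * z.
    by have := ler_pM (ler0n R 32) (ler0n R 32) z32 z32; clear; lra.
  have z3 : 1024 <= z * z * z by move: z2 z32; clear; nra.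
  rewrite -(mulrA 16).
  move: q1 zf1 z3; set y := `|_| * _; set w := z * z ^+ f; clear; nra.
(* The variation parameter is 0: the step function is constant away from its jumps. *)
have := @fejer_approx R N J (fun j => quad_phase (xi * b) (a + j * D)) x G bad k' 0 B N0 k0 (lexx 0).
move=> H; have {}H : nrm (\sum_(j < J) quad_phase (xi * b) (a + j * D) * G (x j)) <=
   N%:R * B + J%:R * (0 + 8 / (N%:R * k' ^+ 2)) + 2 * (\sum_(n < J) bad (x n))%:R.
  apply: H; last by rewrite ltW // /B.
  - by move=> n; rewrite nrm_e.
  - by move=> y; rewrite nrm_e.
  - move=> y l; rewrite /G mulrDr -[D%:R]/((D%:Z)%:~R) -intrM.
    rewrite floorDrz ?intr_int // intrKfloor intrD mulrDr.
    rewrite -[RHS](eDint _ (- (u * a%:Z) * l)); congr e; congr (_ + _).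
    by rewrite !intrM intrN; field; rewrite gt_eqF.
  - move=> y y' /asboolP nb yy'; rewrite /G.
    rewrite (_ : Num.floor (D%:R * y') = Num.floor (D%:R * y)) ?subrr ?nrm0 //.
    apply: (floor_local (k := D%:R * k')) => [l|].
      by rewrite ltNge; apply/negP => hl; apply: nb; exists l.
    by rewrite -mulrBr normrM normr_nat ler_pM2l.
  - move=> i i'; have [->|ii'] := eqVneq i i'; [left|right; exact: four].
    under eq_bigr => j _ do rewrite subrr mulr0 eE0 mulr1.
    exact: sum_step_phase.
have GF j : G (x j) = F j.
  rewrite /G /F; congr (e (_ * (Num.floor _)%:~R)).
  by rewrite /x; field; rewrite gt_eqF.
have {H} : nrm (\sum_(j < J) quad_phase (xi * b) (a + j * D) * F j) <=
   N%:R * B + J%:R * (0 + 8 / (N%:R * k' ^+ 2)) + 2 * (\sum_(n < J) bad (x n))%:R.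
  apply: le_trans H; rewrite (eq_bigr (fun j : 'I_J =>
    quad_phase (xi * b) (a + j * D) * G (x j))) // => j _.
  by rewrite GF.
set t := P%:R / z ^+ (c + 6).
have zt m : (m + (c + 6) <= iN + (M * iN + f + 5) + (c + 6))%N -> z ^+ m <= t.
  by move=> hm; rewrite ler_pdivlMr // -exprD; apply: le_trans zP; exact: zle.
have p1 : N%:R * B <= t.
  apply: le_trans (zt (iN + (M * iN + f + 5))%N (leqnn _)).
  by rewrite exprD ler_pM // ltW // /B.
have p2 : J%:R * (0 + 8 / (N%:R * k' ^+ 2)) <= 8 * t.
  have q : (N%:R * k' ^+ 2)^-1 <= (z ^+ (c + 6))^-1.
    rewrite lef_pV2 ?posrE ?mulr_gt0 ?exprn_gt0 ?ltr0n //.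
    rewrite /k' exprVn -exprM ler_pdivlMr // -exprD m6.
    exact: Nge.
  rewrite add0r mulrCA ler_pM2l //; apply: ler_pM => //.
  by rewrite invr_ge0 mulr_ge0 ?sqr_ge0.
have p3 : 2 * (\sum_(n < J) bad (x n))%:R <= 4 * t.
  have c1 := @gap_count R (b * D%:R) (b * a%:R) (D%:R * k') Q J Q0 gap.
  have c2 : (\sum_(n < J) bad (x n) <= (J %/ Q).+1)%N.
    apply: leq_trans c1; apply: leq_sum => n _.
    by rewrite /bad xE.
  have c4 : (J %/ Q)%:R <= t.
    rewrite ler_pdivlMr //; apply: le_trans (ler_wpM2l (ler0n R _) Qge) _.
    by rewrite -natrM; apply: le_trans JP; rewrite ler_nat leq_divM.
  have c5 : 1 <= t by rewrite -[leLHS](expr0 z) zt // add0n.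
  have : (\sum_(n < J) bad (x n))%:R <= (J %/ Q)%:R + 1 :> R.
    by rewrite natr1 ler_nat.
  by move: c4 c5; clear; lra.
have p4 : 16 * z ^+ f <= t.
  apply: (@le_trans _ _ (z ^+ f.+1)); first by rewrite pow_absorb // ler_nat.
  exact: zt.
move=> p5; apply: le_trans err _; apply: le_trans (lerD p5 p4) _.
have -> : P%:R / z ^+ (c + 4) = t * (z * z).
  by rewrite /t [z ^+ (c + 6)]exprD [z ^+ (c + 4)]exprD; field; rewrite !gt_eqF.
have t0 : 0 <= t by rewrite divr_ge0 // ltW.
have z2 : 1024 <= z * z.
  by have := ler_pM (ler0n R 32) (ler0n R 32) z32 z32; clear; lra.
apply: (@le_trans _ _ (t * 1024)); last by rewrite ler_wpM2l.
by move: p1 p2 p3 t0; clear; lra.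
Qed.

Lemma Re_sum (R : realType) (n : nat) (F : nat -> R[i]) :
  complex.Re (\sum_(j < n) F j) = \sum_(j < n) complex.Re (F j).
Proof. exact: (raddf_sum (@complex.Re R)). Qed.

(** Here u a / D is an integer, so the floor has no effect beyond the [xi] part. Up to small errors
    the real part is a sum of cos(A j^2), bounded below by [sum_cos_sqr_ge]. *)
Lemma class_main (R : realType) (b z xi : R) (P D J a c f : nat) (u : int) :
  32 <= z -> `|b| + 1 <= z -> (0 < D)%N -> D%:R <= z ^+ c ->
  `|xi| <= z ^+ f / P%:R ^+ 2 -> (a < D)%N -> (J * D <= P)%N ->
  (D %| u * a%:Z)%Z ->
  z ^+ ((f + c + 3) + (c + 4)) <= P%:R ->
  - (P%:R / z ^+ (c + 4)) <=
    complex.Re (\sum_(j < J) bracket b (u%:~R / D%:R + xi) (a + j * D)).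
Proof.
move=> z32 bz D0 Dz hxi aD JDP /dvdzP[q uaE] zP.
have z0 : 0 < z by apply: lt_le_trans z32.
have z1 : 1 <= z by apply: le_trans z32; rewrite ler1n.
have zX n : 0 < z ^+ n by exact: exprn_gt0.
have P0 : 0 < P%:R :> R by exact: lt_le_trans zP.
have DR : 0 < D%:R :> R by rewrite ltr0n.
have JP : J%:R <= P%:R :> R.
  by rewrite ler_nat (leq_trans _ JDP) // leq_pmulr.
have nP j : (j < J)%N -> (a + j * D)%:R <= P%:R :> R.
  move=> jJ; rewrite ler_nat (leq_trans _ JDP) //.
  by apply: leq_trans (leq_mul jJ (leqnn D)); rewrite mulSn leq_add2r ltnW.
have xiP : `|xi| * P%:R ^+ 2 <= z ^+ f by rewrite -ler_pdivlMr ?exprn_gt0.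
pose y := xi * b; have yP : `|y| * P%:R ^+ 2 <= z * z ^+ f.
  have -> : `|y| * P%:R ^+ 2 = `|b| * (`|xi| * P%:R ^+ 2) by rewrite normrM; ring.
  apply: ler_pM; [by []|by rewrite mulr_ge0 ?sqr_ge0| |exact: xiP].
  by move: bz; clear; lra.
pose A := 2 * pi * (`|y| * D%:R ^+ 2).
have pi0 := pi_ge0 R; have pi4 := @pi_le4 R.
have A0 : 0 <= A by rewrite !mulr_ge0 ?sqr_ge0.
have AJ : A * J%:R ^+ 2 <= 8 * (z * z ^+ f).
  have -> : A * J%:R ^+ 2 = 2 * pi * (`|y| * (J * D)%:R ^+ 2).
    by rewrite /A natrM; ring.
  apply: ler_pM; rewrite ?mulr_ge0 ?sqr_ge0 //; first by move: pi4; clear; lra.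
  by apply: le_trans yP; rewrite ler_wpM2l // ler_sqr ?nnegrE // ler_nat.
have term (j : nat) : (j < J)%N -> cos (A * j%:R ^+ 2) - 16 * `|xi| * P%:R -
    24 * `|y| * D%:R * P%:R <= complex.Re (bracket b (u%:~R / D%:R + xi) (a + j * D)).
  move=> jJ; set n := (a + j * D)%N.
  have := bracket_quad b xi u D0 (erefl n).
  have -> : e (- ((u * a%:Z)%:~R / D%:R) * (Num.floor (b * n%:R))%:~R) = 1 :> R[i].
    rewrite uaE -[RHS](e_int R (- q * Num.floor (b * n%:R))); congr e.
    by rewrite !intrM intrN; field; rewrite gt_eqF.
  rewrite mulr1 => le; have := le_trans (Re_le_nrm _) le.
  have -> : complex.Re (bracket b (u%:~R / D%:R + xi) n - quad_phase (xi * b) n) =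
    complex.Re (bracket b (u%:~R / D%:R + xi) n) - cos (2 * pi * (`|y| * n%:R ^+ 2)).
    rewrite raddfB; congr (_ - _); rewrite /quad_phase /e /= -/y.
    (* Cosine is even, so y can be replaced by |y|. *)
    have [y0|y0] := ger0P y; first by rewrite -cosN; congr cos; ring.
    by congr cos; ring.
  rewrite ler_norml => /andP[h1 _].
  have h2 : 16 * `|xi| * n%:R <= 16 * `|xi| * P%:R by rewrite ler_wpM2l ?mulr_ge0 ?nP.
  have h3 := cos_lip (2 * pi * (`|y| * n%:R ^+ 2)) (A * j%:R ^+ 2).
  (* Replacing n by j D changes the square by a (n + j D), which is at most 2 D P. *)
  have h4 : `|2 * pi * (`|y| * n%:R ^+ 2) - A * j%:R ^+ 2| <= 24 * `|y| * D%:R * P%:R.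
    have -> : 2 * pi * (`|y| * n%:R ^+ 2) - A * j%:R ^+ 2 =
        2 * pi * `|y| * (a%:R * (n%:R + (j * D)%:R)).
      by rewrite /A /n natrD natrM; ring.
    rewrite ger0_norm ?mulr_ge0 //.
    have x1 : a%:R * (n%:R + (j * D)%:R) <= D%:R * (2 * P%:R) :> R.
      apply: ler_pM => //; first by rewrite ler_nat ltnW.
      rewrite mulr_natl mulr2n lerD ?nP // (le_trans _ (nP j jJ)) // ler_nat.
      exact: leq_addl.
    have x2 : 2 * pi * `|y| <= 8 * `|y| by rewrite ler_wpM2r //; move: pi4; clear; lra.
    apply: le_trans (ler_pM _ _ x2 x1) _; rewrite ?mulr_ge0 //.
    have : 0 <= `|y| * D%:R * P%:R by rewrite !mulr_ge0.
    by clear; lra.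
  have := ler_norm (cos (A * j%:R ^+ 2) - cos (2 * pi * (`|y| * n%:R ^+ 2))).
  rewrite distrC; move: h1 h2 h3 h4; clear; lra.
rewrite (Re_sum _ (fun j => bracket b (u%:~R / D%:R + xi) (a + j * D))).
apply: (@le_trans _ _ (\sum_(j < J) (cos (A * j%:R ^+ 2) - 16 * `|xi| * P%:R -
    24 * `|y| * D%:R * P%:R))); last by apply: ler_sum => j _; exact: term.
rewrite !sumrB !sumr_const card_ord -(mulr_natr (16 * `|xi| * P%:R))
  -(mulr_natr (24 * `|y| * D%:R * P%:R)).
have s1 := sum_cos_sqr_ge J A0.
have s2 : 16 * `|xi| * P%:R * J%:R <= 16 * z ^+ f.
  rewrite -!(mulrA 16) ler_pM2l //; apply: le_trans xiP; rewrite -mulrA ler_wpM2l //.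
  by rewrite expr2 ler_wpM2l.
have s3 : 24 * `|y| * D%:R * P%:R * J%:R <= 24 * (z * z ^+ f * z ^+ c).
  have -> : 24 * `|y| * D%:R * P%:R * J%:R = 24 * (`|y| * (P%:R * J%:R) * D%:R) by ring.
  rewrite ler_pM2l //; apply: ler_pM; [by rewrite !mulr_ge0|by []| |exact: Dz].
  by apply: le_trans yP; rewrite ler_wpM2l // expr2 ler_wpM2l.
have s4 : z * z ^+ f * z ^+ c * (z * z) <= P%:R / z ^+ (c + 4).
  rewrite ler_pdivlMr //; apply: le_trans zP; rewrite [leRHS]exprD ler_pM2r //.
  by have -> : z ^+ (f + c + 3) = z * z ^+ f * z ^+ c * (z * z) by rewrite !exprD; ring.
have c1 : 1 <= z ^+ c by exact: exprn_ege1.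
have f0 := zX f; have zf0 : 0 < z * z ^+ f by rewrite mulr_gt0.
have g1 : z ^+ f <= z * z ^+ f by rewrite ler_peMl // ltW.
have g2 : z * z ^+ f <= z * z ^+ f * z ^+ c by rewrite ler_peMr // ltW.
have z2 : 1024 <= z * z.
  by have := ler_pM (ler0n R 32) (ler0n R 32) z32 z32; clear; lra.
have g3 : z * z ^+ f * z ^+ c * 1024 <= z * z ^+ f * z ^+ c * (z * z).
  by rewrite ler_wpM2l // !mulr_ge0 // ltW.
move: AJ s1 s2 s3 s4 g1 g2 g3 zf0; clear; lra.
Qed.

(** Each of the D classes is at least -P / z^(c + 4); as D <= z^c, together they lose at most P /
    z^4. The incomplete last period has fewer than D terms. *)
Lemma major_arc (R : realType) (b z xi : R) (M P D c f i0 kp iN : nat) (u : int) :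
  i0 = (2 * c + 7)%N -> kp = (M * i0 + c + 2)%N -> iN = (2 * c + 2 * kp + 7)%N ->
  32 <= z -> `|b| + 1 <= z -> dioph b z M -> (0 < D)%N -> D%:R <= z ^+ c ->
  `|xi| <= z ^+ f / P%:R ^+ 2 ->
  z ^+ (iN + (M * iN + f + 5) + (2 * c + 7)) <= P%:R ->
  - (P%:R / z) <= complex.Re (\sum_(n < P) bracket b (u%:~R / D%:R + xi) n).
Proof.
move=> i0E kpE iNE; set A := (iN + _ + _)%N.
have m1 : (iN + (M * iN + f + 5) + (c + 6) <= A)%N by rewrite /A; clear; lia.
have m2 : ((f + c + 3) + (c + 4) <= A)%N by rewrite /A; clear; lia.
have m3 : (c + 2 <= A)%N by rewrite /A; clear; lia.
clearbody A; move=> z32 bz dio D0 Dz hxi zP.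
have z0 : 0 < z by apply: lt_le_trans z32.
have z1 : 1 <= z by apply: le_trans z32; rewrite ler1n.
have zX n : 0 < z ^+ n by exact: exprn_gt0.
have zle m n : (m <= n)%N -> z ^+ m <= z ^+ n by exact: ler_weXn2l.
have P0 : 0 < P%:R :> R by exact: lt_le_trans zP.
pose J := (P %/ D)%N; pose F := bracket b (u%:~R / D%:R + xi).
have JDP : (J * D <= P)%N by exact: leq_divM.
have PE : (P = D * J + P %% D)%N by rewrite {1}(divn_eq P D) mulnC.
have hclass (a : 'I_D) : - (P%:R / z ^+ (c + 4)) <=
    complex.Re (\sum_(j < J) F (a + j * D)%N).
  have [dv|nd] := boolP (D %| u * a%:Z)%Z.
    by apply: (class_main z32 bz D0 Dz hxi) => //; apply: le_trans zP; exact: zle.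
  have zP1 : z ^+ (iN + (M * iN + f + 5) + (c + 6)) <= P%:R.
    by apply: le_trans zP; exact: zle.
  have := class_cancel i0E kpE iNE z32 bz dio D0 Dz hxi (ltn_ord a) JDP nd zP1.
  by move=> le; have := le_trans (Re_le_nrm _) le; rewrite ler_norml => /andP[].
have -> : \sum_(n < P) F n = \sum_(n < D * J + P %% D) F n by rewrite -PE.
rewrite big_split_ord /= raddfD /= (sum_mod_split F).
have h1 : - (P%:R / z ^+ 4) <= complex.Re (\sum_(a < D) \sum_(j < J) F (a + j * D)%N).
  rewrite (Re_sum D (fun a => \sum_(j < J) F (a + j * D)%N)).
  apply: (@le_trans _ _ (\sum_(a < D) - (P%:R / z ^+ (c + 4)))).
    rewrite sumr_const card_ord -(mulr_natl _ D) mulrN lerN2.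
    have -> : D%:R * (P%:R / z ^+ (c + 4)) = (D%:R / z ^+ c) * (P%:R / z ^+ 4).
      by rewrite exprD; field; rewrite !gt_eqF.
    have q0 : 0 <= P%:R / z ^+ 4 by rewrite divr_ge0 // ltW.
    by apply: ler_piMl => //; rewrite ler_pdivrMr // mul1r.
  by apply: ler_sum => a _; exact: hclass.
have h2 : - z ^+ c <= complex.Re (\sum_(i < P %% D) F (D * J + i)%N).
  have : nrm (\sum_(i < P %% D) F (D * J + i)%N) <= z ^+ c.
    apply: le_trans (le_nrm_sum _ _ _) _.
    under eq_bigr => i _ do rewrite nrm_bracket.
    rewrite sumr_const card_ord; apply: le_trans Dz.
    by rewrite ler_nat ltnW // ltn_mod.
  by move=> le; have := le_trans (Re_le_nrm _) le; rewrite ler_norml => /andP[].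
have h3 : z ^+ c * z <= P%:R / z.
  rewrite ler_pdivlMr // -!exprSr; apply: le_trans zP; apply: zle.
  by rewrite -addn2.
have h4 : P%:R / z ^+ 4 * z <= P%:R / z.
  have -> : P%:R / z ^+ 4 * z = P%:R / z * (z ^+ 2)^-1 by field; rewrite gt_eqF.
  have q0 : 0 <= P%:R / z by rewrite divr_ge0 // ltW.
  by apply: ler_piMr => //; rewrite invf_le1 // exprn_ege1.
have c0 := zX c; have p0 : 0 <= P%:R / z ^+ 4 by rewrite divr_ge0 // ltW.
by move: h1 h2 h3 h4 z32 c0 p0; clear; nra.
Qed.

(** * Choice of exponents and conclusion *)

(** Either the sum has norm at most P / z, or its frequency is close enough to a rational for
    [major_arc]. All exponents depend only on M, and [A] exceeds the three that are required of
    P. *)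
Lemma bracket_sum_ge (R : realType) (b : R) :
  irrational b -> non_liouville b -> irrational (b ^+ 2) -> non_liouville (b ^+ 2) ->
  exists (A : nat) (z0 : R), (0 < A)%N /\ forall (t z : R) (P : nat),
    z0 <= z -> z ^+ A <= P%:R ->
    - (P%:R / z) <= complex.Re (\sum_(n < P) bracket b t n).
Proof.
move=> irr nl irr2 nl2.
have [C1 [M1 dio1]] := non_liouville_dioph irr nl.
have [C2 [M2 dio2]] := non_liouville_dioph irr2 nl2.
pose M := maxn M1 M2; pose K := (10 * M + 20)%N; pose c := (4 * M + 11)%N.
pose d := (14 * M + 31)%N; pose g := (c + d + (M * (c + K + 1) + c + 4))%N.
pose f := (K + g + 5)%N; pose i0 := (2 * c + 7)%N; pose kp := (M * i0 + c + 2)%N.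
pose iN := (2 * c + 2 * kp + 7)%N.
pose A1 := (M * (28 * M + 68) + 28 * M + 80)%N; pose A2 := (g + K + 10)%N.
pose A3 := (iN + (M * iN + f + 5) + (2 * c + 7))%N.
exists (A1 + A2 + A3).+1, (32 + `|C1| + `|C2| + `|b| + `|b|^-1); split=> // t z P zz zP.
have b0 : 0 < `|b|.
  rewrite normr_gt0; apply/eqP => bE; apply: irr; rewrite bE.
  by apply/rationalP; exists 0, 1%N; rewrite mul0r.
have bV : 0 < `|b|^-1 by rewrite invr_gt0.
have z32 : 32 <= z.
  by move: zz b0 bV (normr_ge0 C1) (normr_ge0 C2); clear; lra.
have bz : `|b| + 1 <= z.
  by move: zz b0 bV (normr_ge0 C1) (normr_ge0 C2); clear; lra.
have zb : 1 <= z * `|b|.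
  rewrite -ler_pdivrMr // div1r.
  by move: zz b0 bV (normr_ge0 C1) (normr_ge0 C2); clear; lra.
have C1z : C1 <= z.
  apply: le_trans (ler_norm C1) _.
  by move: zz b0 bV (normr_ge0 C2); clear; lra.
have C2z : C2 <= z.
  apply: le_trans (ler_norm C2) _.
  by move: zz b0 bV (normr_ge0 C1); clear; lra.
have z1 : 1 <= z by apply: le_trans z32; rewrite ler1n.
have d1 : dioph b z M := dioph_le z1 (leq_maxl _ _) (dio1 z C1z).
have d2 : dioph (b ^+ 2) z M := dioph_le z1 (leq_maxr _ _) (dio2 z C2z).
have zle m : (m <= (A1 + A2 + A3).+1)%N -> z ^+ m <= P%:R.
  by move=> h; apply: le_trans zP; exact: ler_weXn2l.
have n1 : (A1 <= (A1 + A2 + A3).+1)%N by clear; lia.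
have n2 : (A2 <= (A1 + A2 + A3).+1)%N by clear; lia.
have n3 : (A3 <= (A1 + A2 + A3).+1)%N by clear; lia.
have [small|big] := leP (nrm (\sum_(n < P) bracket b t n)) (P%:R / z).
  by have := le_trans (Re_le_nrm _) small; rewrite ler_norml => /andP[].
have [D [u [D0 Dz tD]]] := rational_approx z32 bz d1 d2 (zle _ n1) (ltW big).
pose xi := t - u%:~R / D%:R; have tE : t = u%:~R / D%:R + xi by rewrite /xi addrC subrK.
rewrite tE in big *.
have hxi := rational_approx_sharp (erefl K) (erefl g) z32 bz zb d1 D0 Dz tD
  (zle _ n2) (ltW big).
exact: (major_arc u (erefl i0) (erefl kp) (erefl iN) z32 bz d1 D0 Dz hxi (zle _ n3)).
Qed.

Theorem lemma1p3 (R : realType) (beta : R)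
    (beta_irr : irrational beta) (beta_nl : non_liouville beta)
    (beta2_irr : irrational (beta ^+ 2))
    (beta2_nl : non_liouville (beta ^+ 2)) :
  exists c' X0 : R, 0 < c' /\
    forall theta X : R, X0 <= X ->
      - (X `^ (1 - c')) <=
        complex.Re (\sum_(1 <= n < (Num.truncn X).+1)
          e (- theta * n%:R * (Num.floor (beta * n%:R))%:~R)).
Proof.
have [A [z0 [A0 H]]] := bracket_sum_ge beta_irr beta_nl beta2_irr beta2_nl.
pose w0 : R := Num.max 8 z0.
(* With w = X^(1 / (2 A)), the bound is applied at z = w^2. It saves w^2 where only w is claimed,
   and the spare factor w >= 8 absorbs the constants. *)
exists (2 * A)%:R^-1, (w0 ^+ (2 * A)); split.
  by rewrite invr_gt0 ltr0n muln_gt0.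
move=> theta X hX.
have w8 : 8 <= w0 by rewrite le_max lexx.
have w1 : 1 <= w0 by apply: le_trans w8; rewrite ler1n.
have X0 : 0 < X by apply: lt_le_trans hX; rewrite exprn_gt0 // (lt_le_trans ltr01).
have AR : (2 * A)%:R != 0 :> R by rewrite pnatr_eq0 muln_eq0 /= -lt0n.
pose w := X `^ (2 * A)%:R^-1.
have wX : w ^+ (2 * A) = X.
  by rewrite -powR_mulrn ?powR_ge0 // -powRrM mulVf // powRr1 // ltW.
have w0w : w0 <= w.
  rewrite -(@ler_pXn2r _ (2 * A)%N) ?muln_gt0 //.
  - by rewrite wX.
  - by rewrite nnegrE (le_trans ler01).
  - by rewrite nnegrE powR_ge0.
have {}w8 : 8 <= w by exact: le_trans w0w.
have wp : 0 < w by apply: lt_le_trans w8.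
have XE : X `^ (1 - (2 * A)%:R^-1) = X / w.
  rewrite powRB; last by rewrite (gt_eqF X0) implybT.
  by rewrite powRr1 // ltW.
have /andP[t1 t2] := truncn_itv (ltW X0).
set P := (Num.truncn X).+1 in t2 *.
have zP : (w ^+ 2) ^+ A <= P%:R by rewrite -exprM wX ltW.
have zw : z0 <= w ^+ 2.
  apply: le_trans (_ : w <= _).
    by apply: le_trans w0w; rewrite le_max lexx orbT.
  by rewrite expr2 ler_peMr ?(ltW wp) //; move: w8; clear; lra.
have := H theta (w ^+ 2) P zw zP; rewrite XE.
(* The term n = 0, equal to 1, belongs to [bracket_sum_ge] but not to the theorem. *)
have -> : \sum_(n < P) bracket beta theta n = 1 + \sum_(1 <= n < P)
    e (- theta * n%:R * (Num.floor (beta * n%:R))%:~R).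
  rewrite -(big_mkord xpredT (bracket beta theta)) big_ltn //; congr (_ + _).
  by rewrite /bracket mulr0 mul0r eE0.
rewrite raddfD /= => le.
have P2 : P%:R <= 2 * X.
  have : 1 <= X by apply: le_trans hX; rewrite exprn_ege1.
  by move: t1; rewrite /P -(natr1 (Num.truncn X)); clear; lra.
have p1 : P%:R / w ^+ 2 <= X / w / 4.
  rewrite ler_pdivrMr ?exprn_gt0 //.
  have -> : X / w / 4 * w ^+ 2 = X * (w / 4) by field; rewrite gt_eqF.
  apply: le_trans P2 _; rewrite mulrC ler_pM2l //.
  by move: w8; clear; lra.
(* This makes the term n = 0 cost at most a quarter of X / w, as the main error does by [p1]. *)
have p2 : 4 <= X / w.
  rewrite ler_pdivlMr // -wX -[(2 * A)%N]prednK ?muln_gt0 // exprS.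
  have : w ^+ 1 <= w ^+ (2 * A).-1.
    rewrite ler_weXn2l //; first by move: w8; clear; lra.
    by move: A0; clear; lia.
  by rewrite expr1; move: w8; clear; nra.
by move: le p1 p2; clear; lra.
Qed.
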